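(* Let $X$ be an array-weighted set, let $\mathrm{MBanSp}(X)$ be its scaled-free matricial Banach space and $\eta_X:X\to \mathrm{MBanSp}(X)$ the associated map of generators. Given a matricial Banach space $W$ and a completely bounded map $\phi:X\to W$ (with $W$ regarded as an array-weighted set), there is a unique completely bounded linear map $\hat\phi:\mathrm{MBanSp}(X)\to W$ such that $\hat\phi\circ\eta_X=\phi$. Moreover, $$\mathrm{cbnd}(\phi)\geq\|\hat\phi\|_{\mathcal{CB}(\mathrm{MBanSp}(X),W)}.$$
   Context: Arrays: $\mathbb{N}=\{1,2,\dots\}$ and $[n]=\{1,\dots,n\}$. For a set $S$, $M_{m,n}(S)$ is the set of functions $A:[m]\times[n]\to S$; for a function $\phi:S\to T$, $M_{m,n}(\phi)(A):=\phi\circ A$. All vector spaces are complex. $\mathbb{M}_{m,n}=M_{m,n}(\mathbb{C})$ carries the operator norm from Euclidean $\mathbb{C}^n$ to Euclidean $\mathbb{C}^m$; scalar matrices act on $M_{m,n}(V)$ on both sides by matrix multiplication. Matrix-normed spaces: a matrix-norm on a vector space $V$ is a family of norms $\|\cdot\|_{V,m,n}$ on $M_{m,n}(V)$ ($m,n\in\mathbb{N}$) with $\|ABC\|_{V,k,l}\le\|A\|_{\mathbb{M}_{k,m}}\|B\|_{V,m,n}\|C\|_{\mathbb{M}_{n,l}}$ for all $A\in\mathbb{M}_{k,m}$, $B\in M_{m,n}(V)$, $C\in\mathbb{M}_{n,l}$. $V$ with a matrix-norm is a matrix-normed space; it is a matricial Banach space if the norm on $M_{1,1}(V)\cong V$ is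 complete. A linear map $\phi:V\to W$ of matrix-normed spaces is completely bounded if $\|\phi\|_{\mathcal{CB}(V,W)}:=\sup_{m,n}\|M_{m,n}(\phi)\|<\infty$ (operator norms), and completely contractive if this is $\le1$. $\mathrm{MIN}(\mathbb{C})$ is $\mathbb{C}$ with $\|A\|_{\mathrm{MIN}(\mathbb{C}),m,n}=\|A\|_{\mathbb{M}_{m,n}}$. Array-weighted sets: an array-weight on a set $X$ is a family $w_{X,m,n}:M_{m,n}(X)\to[0,\infty)$ ($m,n\in\mathbb{N}$) such that (i) $w_{X,j,k}(A\circ(\alpha\times\beta))\le w_{X,m,n}(A)$ for all $1\le j\le m$, $1\le k\le n$, $A\in M_{m,n}(X)$ and one-to-one $\alpha:[j]\to[m]$, $\beta:[k]\to[n]$; (ii) $w_{X,m,n}(A)\le w_{X,j,n}(A\circ(\alpha\times\mathrm{id}_{[n]}))+w_{X,m-j,n}(A\circ(\gamma\times\mathrm{id}_{[n]}))$ for $1\le j<m$ and one-to-one $\alpha:[j]\to[m]$, $\gamma:[m-j]\to[m]$ with disjoint ranges; (iii) $w_{X,m,n}(A)\le w_{X,m,k}(A\circ(\mathrm{id}_{[m]}\times\beta))+w_{X,m,n-k}(A\circ(\mathrm{id}_{[m]}\times\delta))$ for $1\le k<n$ and one-to-one $\beta:[k]\to[n]$, $\delta:[n-k]\to[n]$ with disjoint ranges. An array-weighted set is a set with an array-weight. A function $\phi:X\to Y$ of array-weighted sets is completely bounded if there is $L\ge0$ with $w_{Y,m,n}(M_{m,n}(\phi)(A))\le L\,w_{X,m,n}(A)$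 for all $m,n$ and $A\in M_{m,n}(X)$; $\mathrm{cbnd}(\phi)$ is the infimum of such $L$; $\phi$ is completely contractive if $\mathrm{cbnd}(\phi)\le1$. Every matrix-normed space is an array-weighted set with its matrix-norms as weights. Construction of $\mathrm{MBanSp}(X)$: let $V_X$ be the free complex vector space on $X$, $\theta_X:X\to V_X$ the embedding of generators, $N_X$ the subspace of all $v\in V_X$ such that $\phi(v)=0$ for every linear $\phi:V_X\to\mathrm{MIN}(\mathbb{C})$ with $\phi\circ\theta_X$ completely contractive, $Q_X:=V_X/N_X$ with quotient map $q_X$. Equip $Q_X$ with the matrix-norm $\|A\|_{Q_X,m,n}:=\sup\|M_{m,n}(\phi)(A)\|_{W,m,n}$, the supremum over all matricial Banach spaces $W$ and linear $\phi:Q_X\to W$ with $\phi\circ q_X\circ\theta_X$ completely contractive. $\mathrm{MBanSp}(X)$ is the completion of $Q_X$ as a matrix-normed space: the norm completion of $(Q_X,\|\cdot\|_{Q_X,1,1})$ with $\kappa_{Q_X}$ the canonical embedding and $\|A\|_{m,n}:=\lim_p\|B_p\|_{Q_X,m,n}$ for any sequence $B_p\in M_{m,n}(Q_X)$ converging entrywise to $A$. Finally $\eta_X:=\kappa_{Q_X}\circ q_X\circ\theta_X$. *)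

(* Defs.v *)
From HB Require Import structures.
From mathcomp Require Import all_boot all_order all_algebra.
From mathcomp Require Import all_classical all_reals.
From mathcomp Require Import topology normedtype sequences ereal.
From mathcomp Require Import complex freeg ring.

Set Implicit Arguments.
Unset Strict Implicit.
Unset Printing Implicit Defensive.

Import Order.TTheory GRing.Theory Num.Theory.
Import numFieldNormedType.Exports.

Local Open Scope classical_set_scope.
Local Open Scope ring_scope.

(* Vector spaces are complex: the scalars are R[i], with R : realType, and norms
   and weights take values in R. *)

Section OperatorNorm.
Context {R : realType}.
Local Notation C := R[i].

Definition norm2 n (x : 'cV[C]_n) : R :=
  Num.sqrt (\sum_i Normc.normc (x i 0) ^+ 2).

Definition opnorm m n (A : 'M[C]_(m, n)) : R :=
  sup [set norm2 (A *m x) | x in [set x : 'cV[C]_n | norm2 x <= 1]].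

End OperatorNorm.

Section OperatorNormTheory.
Context {R : realType}.
Local Notation C := R[i].
Local Notation normc := (@Normc.normc R).

Lemma normc_ge0 (z : C) : 0 <= normc z.
Proof. by case: z => a b; exact: sqrtr_ge0. Qed.

Lemma normcD (x y : C) : normc (x + y) <= normc x + normc y.
Proof. exact: le_normcD. Qed.

Lemma normc_0 : normc 0 = 0. Proof. exact: Normc.normc0. Qed.

Lemma normc_N (x : C) : normc (- x) = normc x.
Proof. by rewrite -mulN1r Normc.normcM normcN Normc.normc1 mul1r. Qed.

Lemma normc_sum (I : Type) (r : seq I) (P : pred I) (F : I -> C) :
  normc (\sum_(i <- r | P i) F i) <= \sum_(i <- r | P i) normc (F i).
Proof.
elim/big_ind2: _ => [|x a y b xa yb|//]; first by rewrite normc_0.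
by apply: (le_trans (normcD _ _)); exact: lerD.
Qed.

Lemma sumsq_ge0 n (x : 'cV[C]_n) : 0 <= \sum_i normc (x i 0) ^+ 2.
Proof. by apply: sumr_ge0 => i _; exact: sqr_ge0. Qed.

Lemma norm2_ge0 n (x : 'cV[C]_n) : 0 <= norm2 x.
Proof. exact: sqrtr_ge0. Qed.

Lemma sqr_norm2 n (x : 'cV[C]_n) : norm2 x ^+ 2 = \sum_i normc (x i 0) ^+ 2.
Proof. by rewrite sqr_sqrtr // sumsq_ge0. Qed.

Lemma norm2_le n (x : 'cV[C]_n) M :
  0 <= M -> \sum_i normc (x i 0) ^+ 2 <= M ^+ 2 -> norm2 x <= M.
Proof.
move=> M0 h; rewrite -(@ler_pXn2r _ 2) ?nnegrE ?norm2_ge0 //.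
by rewrite sqr_norm2.
Qed.

Lemma norm2_0 n : norm2 (0 : 'cV[C]_n) = 0.
Proof.
apply/eqP; rewrite -sqrf_eq0 sqr_norm2 big1 // => i _.
by rewrite mxE normc_0 expr0n.
Qed.

Lemma norm2_entry n (x : 'cV[C]_n) i : normc (x i 0) <= norm2 x.
Proof.
rewrite -(@ler_pXn2r _ 2) ?nnegrE ?norm2_ge0 ?normc_ge0 // sqr_norm2.
by rewrite (bigD1 i) //= lerDl; apply: sumr_ge0 => j _; exact: sqr_ge0.
Qed.

Lemma norm2_eq0 n (x : 'cV[C]_n) : norm2 x = 0 -> x = 0.
Proof.
move=> x0; apply/colP => i; rewrite mxE; apply: Normc.eq0_normc.
by apply/le_anti; rewrite normc_ge0 -x0 norm2_entry.
Qed.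

Lemma norm2Z n (c : C) (x : 'cV[C]_n) : norm2 (c *: x) = normc c * norm2 x.
Proof.
apply/eqP; rewrite -(@eqrXn2 _ 2) ?mulr_ge0 ?norm2_ge0 ?normc_ge0 //.
rewrite exprMn !sqr_norm2 mulr_sumr; apply/eqP/eq_bigr => i _.
by rewrite mxE Normc.normcM exprMn.
Qed.

Lemma cauchy_schwarz n (a b : 'I_n -> R) :
  (\sum_i a i * b i) ^+ 2 <= (\sum_i a i ^+ 2) * (\sum_i b i ^+ 2).
Proof.
rewrite -subr_ge0.
suff -> : (\sum_i a i ^+ 2) * (\sum_i b i ^+ 2) - (\sum_i a i * b i) ^+ 2 =
    2^-1 * \sum_i \sum_j (a i * b j - a j * b i) ^+ 2.
  apply: mulr_ge0; first by rewrite invr_ge0.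
  by apply: sumr_ge0 => i _; apply: sumr_ge0 => j _; exact: sqr_ge0.
have E1 : \sum_i \sum_j a i ^+ 2 * b j ^+ 2 =
    (\sum_i a i ^+ 2) * (\sum_i b i ^+ 2).
  by rewrite mulr_suml; apply: eq_bigr => i _; rewrite mulr_sumr.
have E2 : \sum_i \sum_j a j ^+ 2 * b i ^+ 2 =
    (\sum_i a i ^+ 2) * (\sum_i b i ^+ 2).
  by rewrite exchange_big.
have E3 : \sum_i \sum_j (a i * b i) * (a j * b j) = (\sum_i a i * b i) ^+ 2.
  by rewrite expr2 mulr_suml; apply: eq_bigr => i _; rewrite mulr_sumr.
have -> : \sum_i \sum_j (a i * b j - a j * b i) ^+ 2 =
   \sum_i \sum_j a i ^+ 2 * b j ^+ 2 + \sum_i \sum_j a j ^+ 2 * b i ^+ 2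
   - 2 * \sum_i \sum_j (a i * b i) * (a j * b j).
  rewrite mulr_sumr -sumrN -!big_split /=; apply: eq_bigr => i _.
  rewrite mulr_sumr -sumrN -!big_split /=; apply: eq_bigr => j _.
  by ring.
by rewrite E1 E2 E3; field.
Qed.

Lemma norm2D n (x y : 'cV[C]_n) : norm2 (x + y) <= norm2 x + norm2 y.
Proof.
apply: norm2_le; first by rewrite addr_ge0 ?norm2_ge0.
rewrite sqrrD !sqr_norm2.
have CS : \sum_i normc (x i 0) * normc (y i 0) <= norm2 x * norm2 y.
  rewrite -(@ler_pXn2r _ 2) ?nnegrE ?mulr_ge0 ?norm2_ge0 //; last first.
    by apply: sumr_ge0 => i _; rewrite mulr_ge0 ?normc_ge0.
  by rewrite exprMn !sqr_norm2; exact: cauchy_schwarz.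
apply: (@le_trans _ _ (\sum_i (normc (x i 0) + normc (y i 0)) ^+ 2)).
  apply: ler_sum => i _; rewrite mxE ler_pXn2r ?nnegrE ?addr_ge0 ?normc_ge0 //.
  exact: normcD.
under eq_bigr do rewrite sqrrD.
rewrite big_split big_split /= lerD2r lerD2l sumrMnl.
by rewrite lerMn2r CS orbT.
Qed.

Lemma norm2_bound m n (A : 'M[C]_(m, n)) (x : 'cV[C]_n) :
  norm2 (A *m x) <= (\sum_i \sum_j normc (A i j)) * norm2 x.
Proof.
have h i : normc ((A *m x) i 0) <= (\sum_j normc (A i j)) * norm2 x.
  rewrite mxE (le_trans (normc_sum _ _ _)) // mulr_suml.
  apply: ler_sum => j _; rewrite Normc.normcM.
  by rewrite ler_wpM2l ?normc_ge0 ?norm2_entry.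
have sq (I : Type) (r : seq I) (F : I -> R) : (forall i, 0 <= F i) ->
    \sum_(i <- r) F i ^+ 2 <= (\sum_(i <- r) F i) ^+ 2.
  move=> F0; elim: r => [|a r IH]; first by rewrite !big_nil expr0n.
  rewrite !big_cons sqrrD -addrA lerD2l.
  apply: (le_trans IH); rewrite lerDr mulrn_wge0 // mulr_ge0 //.
  exact: sumr_ge0.
have S0 i : 0 <= \sum_j normc (A i j).
  by apply: sumr_ge0 => j _; exact: normc_ge0.
apply: norm2_le; first by rewrite mulr_ge0 ?norm2_ge0 //; exact: sumr_ge0.
rewrite mulr_suml; apply: le_trans (sq _ _ _ _); last first.
  by move=> i; rewrite mulr_ge0 ?norm2_ge0.
apply: ler_sum => i _; rewrite ler_pXn2r ?nnegrE ?normc_ge0 //.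
by rewrite mulr_ge0 ?norm2_ge0.
Qed.

Lemma opnorm_has_sup m n (A : 'M[C]_(m, n)) :
  has_sup [set norm2 (A *m x) | x in [set x : 'cV[C]_n | norm2 x <= 1]].
Proof.
split; first by exists (norm2 (A *m 0)), 0 => //=; rewrite norm2_0.
exists (\sum_i \sum_j normc (A i j)) => _ [x /= x1 <-].
apply: (le_trans (norm2_bound A x)); rewrite ler_piMr //.
by apply: sumr_ge0 => i _; apply: sumr_ge0 => j _; exact: normc_ge0.
Qed.

Lemma opnorm_ge0 m n (A : 'M[C]_(m, n)) : 0 <= opnorm A.
Proof.
apply: (@le_trans _ _ (norm2 (A *m 0))); first exact: norm2_ge0.
apply: sup_upper_bound; first exact: opnorm_has_sup.
by exists 0 => //=; rewrite norm2_0.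
Qed.

Lemma normc_real (a : R) : 0 <= a -> normc (real_complex R a) = a.
Proof. by move=> a0; rewrite /= expr0n /= addr0 sqrtr_sqr ger0_norm. Qed.

Lemma opnormP m n (A : 'M[C]_(m, n)) (x : 'cV[C]_n) :
  norm2 (A *m x) <= opnorm A * norm2 x.
Proof.
have [->|x0] := eqVneq x 0.
  by rewrite mulmx0 !norm2_0 mulr0.
have nx : 0 < norm2 x.
  by rewrite lt_def norm2_ge0 andbT; apply: contraNneq x0 => /norm2_eq0 ->.
rewrite -ler_pdivrMr // mulrC.
set c := real_complex R (norm2 x)^-1.
have cE : normc c = (norm2 x)^-1 by rewrite normc_real // invr_ge0 ltW.
rewrite -cE -norm2Z scalemxAr.
apply: sup_upper_bound; first exact: opnorm_has_sup.
by exists (c *: x) => //=; rewrite norm2Z cE mulVf // gt_eqF.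
Qed.

Lemma opnorm_le m n (A : 'M[C]_(m, n)) M : 0 <= M ->
  (forall x, norm2 (A *m x) <= M * norm2 x) -> opnorm A <= M.
Proof.
move=> M0 h; apply: ge_sup.
  by exists (norm2 (A *m 0)), 0 => //=; rewrite norm2_0.
move=> _ [x /= x1 <-]; apply: (le_trans (h x)).
by rewrite ler_piMr.
Qed.

Lemma opnormD m n (A B : 'M[C]_(m, n)) : opnorm (A + B) <= opnorm A + opnorm B.
Proof.
apply: opnorm_le => [|x]; first by rewrite addr_ge0 ?opnorm_ge0.
rewrite mulmxDl mulrDl (le_trans (norm2D _ _)) //.
by apply: lerD; exact: opnormP.
Qed.

Lemma opnormM m n p (A : 'M[C]_(m, n)) (B : 'M[C]_(n, p)) :
  opnorm (A *m B) <= opnorm A * opnorm B.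
Proof.
apply: opnorm_le => [|x]; first by rewrite mulr_ge0 ?opnorm_ge0.
rewrite -mulmxA (le_trans (opnormP _ _)) // -mulrA.
by rewrite ler_wpM2l ?opnorm_ge0 ?opnormP.
Qed.

Lemma opnormZ_le m n (c : C) (A : 'M[C]_(m, n)) :
  opnorm (c *: A) <= normc c * opnorm A.
Proof.
apply: opnorm_le => [|x]; first by rewrite mulr_ge0 ?opnorm_ge0 ?normc_ge0.
rewrite -scalemxAl norm2Z -mulrA.
by rewrite ler_wpM2l ?normc_ge0 ?opnormP.
Qed.

Lemma opnormZ m n (c : C) (A : 'M[C]_(m, n)) :
  opnorm (c *: A) = normc c * opnorm A.
Proof.
apply/le_anti; rewrite opnormZ_le /=.
have [->|c0] := eqVneq c 0; first by rewrite normc_0 mul0r opnorm_ge0.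
have nc0 : 0 < normc c.
  rewrite lt_def normc_ge0 andbT; apply: contraNneq c0 => h.
  by rewrite (Normc.eq0_normc h).
rewrite -ler_pdivlMl // -Normc.normcV.
by apply: le_trans (opnormZ_le _ _); rewrite scalerA mulVf // scale1r.
Qed.

Lemma opnorm1 n : opnorm (1%:M : 'M[C]_n) <= 1.
Proof. by apply: opnorm_le => // x; rewrite mul1mx mul1r. Qed.

(* the isometry C^j -> C^m and the coordinate projection C^m -> C^j given by a
   one-to-one map of indices *)
Definition mxemb j m (f : 'I_j -> 'I_m) : 'M[C]_(m, j) :=
  \matrix_(i, l) (i == f l)%:R.
Definition mxres j m (f : 'I_j -> 'I_m) : 'M[C]_(j, m) :=
  \matrix_(l, i) (i == f l)%:R.

Lemma opnorm_mxres j m (f : 'I_j -> 'I_m) :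
  injective f -> opnorm (mxres f) <= 1.
Proof.
move=> fI; apply: opnorm_le => // x; rewrite mul1r.
apply: norm2_le; first exact: norm2_ge0.
rewrite sqr_norm2.
have E l : (mxres f *m x) l 0 = x (f l) 0.
  rewrite mxE (bigD1 (f l)) //= mxE eqxx mul1r big1 ?addr0 // => i /negbTE ifl.
  by rewrite mxE ifl mul0r.
under eq_bigr do rewrite E.
rewrite -(big_imset (fun i => normc (x i 0) ^+ 2) (h := f) (A := predT)) /=;
  last by move=> ? ? _ _; exact: fI.
rewrite [leRHS](bigID (mem (f @: predT))) /= lerDl.
by apply: sumr_ge0 => i _; exact: sqr_ge0.
Qed.

Lemma opnorm_mxemb j m (f : 'I_j -> 'I_m) :
  injective f -> opnorm (mxemb f) <= 1.
Proof.
move=> fI; apply: opnorm_le => // x; rewrite mul1r.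
apply: norm2_le; first exact: norm2_ge0.
rewrite sqr_norm2.
apply: (@le_trans _ _ (\sum_i \sum_l (i == f l)%:R * normc (x l 0) ^+ 2)).
  apply: ler_sum => i _; rewrite mxE.
  have [/existsP[l /eqP ->]|/existsPn ni] := boolP [exists l, i == f l].
    rewrite (bigD1 l) //= [leRHS](bigD1 l) //= mxE eqxx !mul1r !big1 ?addr0 //.
      by move=> k /negbTE kl; rewrite (inj_eq fI) eq_sym kl mul0r.
    by move=> k /negbTE kl; rewrite mxE (inj_eq fI) eq_sym kl mul0r.
  rewrite big1 => [|l _]; last by rewrite mxE (negbTE (ni l)) mul0r.
  rewrite normc_0 expr0n; apply: sumr_ge0 => l _.
  by rewrite mulr_ge0 ?sqr_ge0.
rewrite exchange_big; apply: ler_sum => l _ /=.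
rewrite (bigD1 (f l)) //= eqxx mul1r big1 ?addr0 // => i /negbTE ->.
by rewrite mul0r.
Qed.

Lemma opnorm_const11 (z : C) : opnorm (const_mx z : 'M[C]_1) = normc z.
Proof.
have E (w : C) : norm2 (const_mx w : 'cV[C]_1) = normc w.
  by rewrite /norm2 big_ord1 mxE sqrtr_sqr ger0_norm ?normc_ge0.
apply/le_anti/andP; split.
  apply: opnorm_le => [|x]; first exact: normc_ge0.
  have -> : x = const_mx (x 0 0) by apply/matrixP => i k; rewrite mxE (ord1 i) (ord1 k).
  have -> : (const_mx z : 'M[C]_1) *m const_mx (x 0 0) = const_mx (z * x 0 0) :> 'cV[C]_1.
    by apply/matrixP => i k; rewrite !mxE big_ord1 !mxE.
  by rewrite !E Normc.normcM.
have := opnormP (const_mx z : 'M[C]_1) (const_mx 1).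
have -> : (const_mx z : 'M[C]_1) *m const_mx 1 = const_mx z :> 'cV[C]_1.
  by apply/matrixP => i k; rewrite !mxE big_ord1 !mxE mulr1.
by rewrite !E Normc.normc1 mulr1.
Qed.

Lemma opnorm_entry m n (A : 'M[C]_(m, n)) i j : normc (A i j) <= opnorm A.
Proof.
rewrite -(opnorm_const11 (A i j)).
have -> : const_mx (A i j) =
    mxres (fun _ : 'I_1 => i) *m (A *m mxemb (fun _ : 'I_1 => j)).
  apply/matrixP => k l; rewrite !mxE (bigD1 i) //= big1 => [|p /negbTE pi];
    last by rewrite !mxE pi mul0r.
  rewrite !mxE eqxx mul1r addr0 (bigD1 j) //= big1 => [|p /negbTE pj];
    last by rewrite !mxE pj mulr0.
  by rewrite mxE eqxx mulr1 addr0.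
have inj1 a (b : 'I_a) : injective (fun _ : 'I_1 => b).
  by move=> x y _; rewrite (ord1 x) (ord1 y).
apply: (le_trans (opnormM _ _)).
apply: (@le_trans _ _ (1 * opnorm (A *m mxemb (fun _ : 'I_1 => j)))).
  by rewrite ler_wpM2r ?opnorm_ge0 ?opnorm_mxres.
rewrite mul1r (le_trans (opnormM _ _)) //.
by rewrite ler_piMr ?opnorm_ge0 ?opnorm_mxemb.
Qed.

Lemma opnorm_eq0 m n (A : 'M[C]_(m, n)) : opnorm A = 0 -> A = 0.
Proof.
move=> A0; apply/matrixP => i j; rewrite mxE; apply: Normc.eq0_normc.
by apply/le_anti; rewrite normc_ge0 -A0 opnorm_entry.
Qed.

End OperatorNormTheory.

Section MatrixAction.
Context {R : realType} {V : lmodType R[i]}.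

Definition lactmx k m n (A : 'M[R[i]]_(k, m)) (B : 'M[V]_(m, n)) :
    'M[V]_(k, n) :=
  \matrix_(i, j) \sum_l A i l *: B l j.

Definition ractmx m n l (B : 'M[V]_(m, n)) (D : 'M[R[i]]_(n, l)) :
    'M[V]_(m, l) :=
  \matrix_(i, j) \sum_k D k j *: B i k.

End MatrixAction.

(* Array sizes start at 1, so the (m, n) member of a family of weights or norms
   lives on arrays of size m.+1 x n.+1. In the axioms below, j <= m and k <= n
   follow from the existence of the one-to-one maps. *)

Record array_weight (R : realType) (X : Type)
    (w : forall m n, 'M[X]_(m.+1, n.+1) -> R) : Prop := ArrayWeight {
  array_weight_ge0 : forall m n A, 0 <= w m n A;
  array_weight_sub : forall m n j k (A : 'M[X]_(m.+1, n.+1))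
      (alpha : 'I_j.+1 -> 'I_m.+1) (beta : 'I_k.+1 -> 'I_n.+1),
    injective alpha -> injective beta ->
    w j k (mxsub alpha beta A) <= w m n A;
  array_weight_row : forall m n j j' (A : 'M[X]_(m.+1, n.+1))
      (alpha : 'I_j.+1 -> 'I_m.+1) (gamma : 'I_j'.+1 -> 'I_m.+1),
    (j.+1 + j'.+1 = m.+1)%N ->
    injective alpha -> injective gamma ->
    (forall a b, alpha a <> gamma b) ->
    w m n A <= w j n (rowsub alpha A) + w j' n (rowsub gamma A);
  array_weight_col : forall m n k k' (A : 'M[X]_(m.+1, n.+1))
      (beta : 'I_k.+1 -> 'I_n.+1) (delta : 'I_k'.+1 -> 'I_n.+1),
    (k.+1 + k'.+1 = n.+1)%N ->
    injective beta -> injective delta ->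
    (forall a b, beta a <> delta b) ->
    w m n A <= w m k (colsub beta A) + w m k' (colsub delta A)
}.

Record arrayWeightedSet (R : realType) := ArrayWeightedSet {
  aw_sort :> Type;
  aweight : forall m n, 'M[aw_sort]_(m.+1, n.+1) -> R;
  aweightP : array_weight aweight
}.

Record matrix_norm (R : realType) (V : lmodType R[i])
    (N : forall m n, 'M[V]_(m.+1, n.+1) -> R) : Prop := MatrixNorm {
  matrix_norm_ge0 : forall m n A, 0 <= N m n A;
  matrix_norm_eq0 : forall m n A, N m n A = 0 -> A = 0;
  matrix_normZ : forall m n (c : R[i]) A,
    N m n (map_mx ( *:%R c) A) = Normc.normc c * N m n A;
  matrix_normD : forall m n A B, N m n (A + B) <= N m n A + N m n B;
  matrix_norm_act : forall k m n l (A : 'M[R[i]]_(k.+1, m.+1))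
      (B : 'M[V]_(m.+1, n.+1)) (D : 'M[R[i]]_(n.+1, l.+1)),
    N k l (ractmx (lactmx A B) D) <= opnorm A * N m n B * opnorm D
}.

Record matrixNormedSpace (R : realType) := MatrixNormedSpace {
  mn_sort :> lmodType R[i];
  mnorm : forall m n, 'M[mn_sort]_(m.+1, n.+1) -> R;
  mnormP : matrix_norm mnorm
}.

(* the norm of V itself, i.e. the norm on 1 x 1 arrays *)
Definition vnorm (R : realType) (V : matrixNormedSpace R) (v : V) : R :=
  @mnorm R V 0 0 (const_mx v).

Definition vcauchy (R : realType) (V : matrixNormedSpace R) (u : nat -> V) :=
  forall e : R, 0 < e -> exists N, forall p q,
    (N <= p)%N -> (N <= q)%N -> vnorm (u p - u q) < e.

Definition vcvg (R : realType) (V : matrixNormedSpace R) (u : nat -> V)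
    (v : V) :=
  (fun p => vnorm (u p - v)) @ \oo --> (0 : R).

Record matBanachSpace (R : realType) := MatBanachSpace {
  mb_space :> matrixNormedSpace R;
  mb_complete : forall u : nat -> mb_space,
    vcauchy u -> exists v, vcvg u v
}.

Section MatrixActionTheory.
Context {R : realType} {V : lmodType R[i]}.
Local Notation C := R[i].

Lemma lact1mx m n (B : 'M[V]_(m, n)) : lactmx 1%:M B = B.
Proof.
apply/matrixP => i j; rewrite mxE (bigD1 i) //= mxE eqxx scale1r big1 ?addr0 //.
by move=> l /negbTE li; rewrite mxE eq_sym li scale0r.
Qed.

Lemma ractmx1 m n (B : 'M[V]_(m, n)) : ractmx B 1%:M = B.
Proof.
apply/matrixP => i j; rewrite mxE (bigD1 j) //= mxE eqxx scale1r big1 ?addr0 //.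
by move=> l /negbTE li; rewrite mxE li scale0r.
Qed.

Lemma lactmxres j m n (f : 'I_j -> 'I_m) (B : 'M[V]_(m, n)) :
  lactmx (mxres f) B = rowsub f B.
Proof.
apply/matrixP => i k; rewrite !mxE (bigD1 (f i)) //= mxE eqxx scale1r.
by rewrite big1 ?addr0 // => l /negbTE li; rewrite mxE li scale0r.
Qed.

Lemma ractmxemb k m n (f : 'I_k -> 'I_n) (B : 'M[V]_(m, n)) :
  ractmx B (mxemb f) = colsub f B.
Proof.
apply/matrixP => i l; rewrite !mxE (bigD1 (f l)) //= mxE eqxx scale1r.
by rewrite big1 ?addr0 // => p /negbTE li; rewrite mxE li scale0r.
Qed.

Lemma mem_cover m j j' (f : 'I_j -> 'I_m) (g : 'I_j' -> 'I_m) :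
  (j + j' = m)%N -> injective f -> injective g ->
  (forall a b, f a <> g b) ->
  forall i, (exists a, i = f a) \/ (exists b, i = g b).
Proof.
move=> jm fI gI fg i.
have dis : (f @: 'I_j :&: g @: 'I_j' = finset.set0)%SET.
  apply/setP => x; rewrite !inE; apply/andP => -[/imsetP[a _ ->]].
  by move=> /imsetP[b _]; exact: fg.
have : i \in (f @: 'I_j :|: g @: 'I_j')%SET.
  suff -> : (f @: 'I_j :|: g @: 'I_j' = [set: 'I_m])%SET by rewrite inE.
  apply/eqP; rewrite eqEcard finset.subsetT /= cardsT card_ord cardsU.
  by rewrite dis cards0 subn0 !card_imset // !card_ord jm.
by rewrite inE => /orP[] /imsetP[a _ ->]; [left|right]; exists a.
Qed.

Lemma rowsub_cover m n j j' (f : 'I_j -> 'I_m) (g : 'I_j' -> 'I_m)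
    (B : 'M[V]_(m, n)) :
  (j + j' = m)%N -> injective f -> injective g ->
  (forall a b, f a <> g b) ->
  B = lactmx (mxemb f) (rowsub f B) + lactmx (mxemb g) (rowsub g B).
Proof.
have E1 p (h : 'I_p -> 'I_m) a k : injective h ->
    lactmx (mxemb h) (rowsub h B) (h a) k = B (h a) k.
  move=> hI; rewrite mxE (bigD1 a) //= !mxE eqxx scale1r big1 ?addr0 //.
  by move=> b /negbTE ba; rewrite !mxE (inj_eq hI) eq_sym ba scale0r.
have E2 p (h : 'I_p -> 'I_m) i k : (forall a, i <> h a) ->
    lactmx (mxemb h) (rowsub h B) i k = 0.
  move=> ih; rewrite mxE big1 // => a _; rewrite mxE.
  by case: eqP => [/ih//|_]; rewrite scale0r.
move=> jm fI gI fg; apply/matrixP => i k.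
have [[a ->]|[b ->]] := mem_cover jm fI gI fg i; rewrite [RHS]mxE.
  by rewrite E1 // E2 ?addr0.
by rewrite E2 ?E1 ?add0r // => a /esym; exact: fg.
Qed.

Lemma colsub_cover m n k k' (f : 'I_k -> 'I_n) (g : 'I_k' -> 'I_n)
    (B : 'M[V]_(m, n)) :
  (k + k' = n)%N -> injective f -> injective g ->
  (forall a b, f a <> g b) ->
  B = ractmx (colsub f B) (mxres f) + ractmx (colsub g B) (mxres g).
Proof.
have E1 p (h : 'I_p -> 'I_n) i a : injective h ->
    ractmx (colsub h B) (mxres h) i (h a) = B i (h a).
  move=> hI; rewrite mxE (bigD1 a) //= !mxE eqxx scale1r big1 ?addr0 //.
  by move=> b /negbTE ba; rewrite !mxE (inj_eq hI) eq_sym ba scale0r.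
have E2 p (h : 'I_p -> 'I_n) i l : (forall a, l <> h a) ->
    ractmx (colsub h B) (mxres h) i l = 0.
  move=> ih; rewrite mxE big1 // => a _; rewrite mxE.
  by case: eqP => [/ih//|_]; rewrite scale0r.
move=> jm fI gI fg; apply/matrixP => i l.
have [[a ->]|[b ->]] := mem_cover jm fI gI fg l; rewrite [RHS]mxE.
  by rewrite E1 // E2 ?addr0.
by rewrite E2 ?E1 ?add0r // => a /esym; exact: fg.
Qed.

End MatrixActionTheory.

Section MapAction.
Context {R : realType} {V W : lmodType R[i]}.

Lemma map_lactmx (f : {linear V -> W}) k m n (A : 'M[R[i]]_(k, m))
    (B : 'M[V]_(m, n)) :
  map_mx f (lactmx A B) = lactmx A (map_mx f B).
Proof.
apply/matrixP => i j; rewrite !mxE linear_sum; apply: eq_bigr => l _.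
by rewrite linearZ mxE.
Qed.

Lemma map_ractmx (f : {linear V -> W}) m n l (B : 'M[V]_(m, n))
    (D : 'M[R[i]]_(n, l)) :
  map_mx f (ractmx B D) = ractmx (map_mx f B) D.
Proof.
apply/matrixP => i j; rewrite !mxE linear_sum; apply: eq_bigr => p _.
by rewrite linearZ mxE.
Qed.

Lemma map_mxlin_scale (f : {linear V -> W}) m n (c : R[i]) (B : 'M[V]_(m, n)) :
  map_mx f (map_mx ( *:%R c) B) = map_mx ( *:%R c) (map_mx f B).
Proof. by apply/matrixP => i j; rewrite !mxE linearZ. Qed.

End MapAction.

Section MatrixNormTheory.
Context {R : realType} {V : lmodType R[i]}.
Context {N : forall m n, 'M[V]_(m.+1, n.+1) -> R} (NP : matrix_norm N).

Lemma matrix_norm_lact k m n (A : 'M[R[i]]_(k.+1, m.+1))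
    (B : 'M[V]_(m.+1, n.+1)) : opnorm A <= 1 -> N (lactmx A B) <= N B.
Proof.
move=> A1; have := matrix_norm_act NP A B 1%:M; rewrite ractmx1 => /le_trans.
apply; rewrite -[leRHS]mulr1 ler_pM ?mulr_ge0 ?opnorm_ge0 ?opnorm1 //.
  exact: (matrix_norm_ge0 NP).
by rewrite ler_piMl //; exact: (matrix_norm_ge0 NP).
Qed.

Lemma matrix_norm_ract m n l (B : 'M[V]_(m.+1, n.+1))
    (D : 'M[R[i]]_(n.+1, l.+1)) : opnorm D <= 1 -> N (ractmx B D) <= N B.
Proof.
move=> D1; have := matrix_norm_act NP 1%:M B D; rewrite lact1mx => /le_trans.
apply; rewrite -[leRHS]mulr1 ler_pM ?mulr_ge0 ?opnorm_ge0 ?opnorm1 //.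
  exact: (matrix_norm_ge0 NP).
by rewrite ler_piMl ?opnorm1 //; exact: (matrix_norm_ge0 NP).
Qed.

Lemma matrix_norm_weight : array_weight N.
Proof.
split.
- exact: (matrix_norm_ge0 NP).
- move=> m n j k A alpha beta aI bI.
  have -> : mxsub alpha beta A = ractmx (lactmx (mxres alpha) A) (mxemb beta).
    by rewrite ractmxemb lactmxres; apply/matrixP => a b; rewrite !mxE.
  apply: (le_trans (matrix_norm_ract _ _)); first exact: opnorm_mxemb.
  by apply: matrix_norm_lact; exact: opnorm_mxres.
- move=> m n j j' A f g jm fI gI fg.
  rewrite [in leLHS](rowsub_cover A jm fI gI fg).
  apply: (le_trans (matrix_normD NP _ _)).
  by apply: lerD; apply: matrix_norm_lact; exact: opnorm_mxemb.
- move=> m n k k' A f g kn fI gI fg.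
  rewrite [in leLHS](colsub_cover A kn fI gI fg).
  apply: (le_trans (matrix_normD NP _ _)).
  by apply: lerD; apply: matrix_norm_ract; exact: opnorm_mxres.
Qed.

Lemma matrix_norm0 m n : N (0 : 'M[V]_(m.+1, n.+1)) = 0.
Proof.
have := matrix_normZ NP 0 (0 : 'M[V]_(m.+1, n.+1)).
rewrite normc_0 mul0r => <-; congr N.
by apply/matrixP => i j; rewrite !mxE scale0r.
Qed.

Lemma matrix_normN m n (A : 'M[V]_(m.+1, n.+1)) : N (- A) = N A.
Proof.
have := matrix_normZ NP (- 1) A.
rewrite normc_N Normc.normc1 mul1r => <-; congr N.
by apply/matrixP => i j; rewrite !mxE scaleN1r.
Qed.

Lemma matrix_norm_distB m n (A B : 'M[V]_(m.+1, n.+1)) :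
  `|N A - N B| <= N (A - B).
Proof.
have h (P Q : 'M[V]_(m.+1, n.+1)) : N P - N Q <= N (P - Q).
  by rewrite lerBlDr -{1}(subrK Q P) (matrix_normD NP).
rewrite ler_norml h andbT -matrix_normN opprB.
by rewrite -lerN2 opprK opprB h.
Qed.

Lemma matrix_norm_sum m n (I : Type) (r : seq I) (F : I -> 'M[V]_(m.+1, n.+1)) :
  N (\sum_(i <- r) F i) <= \sum_(i <- r) N (F i).
Proof.
elim: r => [|a r IH]; first by rewrite !big_nil matrix_norm0.
rewrite !big_cons (le_trans (matrix_normD NP _ _)) //.
exact: lerD.
Qed.

Lemma matrix_norm_entry m n (A : 'M[V]_(m.+1, n.+1)) i j :
  N (const_mx (A i j) : 'M[V]_(1, 1)) <= N A.
Proof.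
have inj1 a (b : 'I_a) : injective (fun _ : 'I_1 => b).
  by move=> x y _; rewrite (ord1 x) (ord1 y).
apply: le_trans (array_weight_sub matrix_norm_weight A (inj1 _ i) (inj1 _ j)).
rewrite (_ : mxsub _ _ _ = const_mx (A i j)) //.
by apply/matrixP => a b; rewrite !mxE.
Qed.

Lemma matrix_norm_le_sum m n (A : 'M[V]_(m.+1, n.+1)) :
  N A <= \sum_i \sum_j N (const_mx (A i j) : 'M[V]_(1, 1)).
Proof.
have inj1 a (b : 'I_a) : injective (fun _ : 'I_1 => b).
  by move=> x y _; rewrite (ord1 x) (ord1 y).
have E : A = \sum_i \sum_j ractmx (lactmx (mxemb (fun _ : 'I_1 => i))
    (const_mx (A i j) : 'M[V]_(1, 1))) (mxres (fun _ : 'I_1 => j)).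
  apply/matrixP => a b; rewrite summxE (bigD1 a) //= [X in _ + X]big1 ?addr0.
    rewrite summxE (bigD1 b) //= [X in _ + X]big1 ?addr0.
      by rewrite !(mxE, big_ord1) !eqxx !scale1r.
    by move=> j /negbTE jb; rewrite !(mxE, big_ord1) [b == j]eq_sym jb scale0r.
  move=> i /negbTE ia; rewrite summxE big1 // => j _.
  by rewrite !(mxE, big_ord1) [a == i]eq_sym ia scale0r scaler0.
rewrite [in leLHS]E (le_trans (matrix_norm_sum _ _)) //.
apply: ler_sum => i _; rewrite (le_trans (matrix_norm_sum _ _)) //.
apply: ler_sum => j _.
apply: (le_trans (matrix_norm_ract _ _)); first exact: opnorm_mxres.
by apply: matrix_norm_lact; exact: opnorm_mxemb.
Qed.

End MatrixNormTheory.

Definition mn_aw (R : realType) (V : matrixNormedSpace R) : arrayWeightedSet R :=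
  ArrayWeightedSet (matrix_norm_weight (@mnormP R V)).
Coercion mn_aw : matrixNormedSpace >-> arrayWeightedSet.

Section VectorNormTheory.
Context {R : realType} {V : matrixNormedSpace R}.

Lemma vnorm_ge0 (v : V) : 0 <= vnorm v.
Proof. exact: (matrix_norm_ge0 (@mnormP R V)). Qed.

Lemma vnorm0 : vnorm (0 : V) = 0.
Proof.
rewrite /vnorm (_ : const_mx 0 = 0) ?(matrix_norm0 (@mnormP R V)) //.
Qed.

Lemma vnormD (u v : V) : vnorm (u + v) <= vnorm u + vnorm v.
Proof.
apply: le_trans (matrix_normD (@mnormP R V) _ _).
by rewrite /vnorm (_ : const_mx (u + v) = const_mx u + const_mx v) //;
  apply/matrixP => i j; rewrite !mxE.
Qed.

Lemma vnormN (v : V) : vnorm (- v) = vnorm v.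
Proof.
rewrite -[RHS](matrix_normN (@mnormP R V)) /vnorm; congr mnorm.
by apply/matrixP => i j; rewrite !mxE.
Qed.

Lemma vnormBC (u v : V) : vnorm (u - v) = vnorm (v - u).
Proof. by rewrite -vnormN opprB. Qed.

Lemma vnormZ c (v : V) : vnorm (c *: v) = Normc.normc c * vnorm v.
Proof.
rewrite -(matrix_normZ (@mnormP R V)) /vnorm; congr mnorm.
by apply/matrixP => i j; rewrite !mxE.
Qed.

Lemma vnorm_eq0 (v : V) : vnorm v = 0 -> v = 0.
Proof.
move=> /(matrix_norm_eq0 (@mnormP R V)) /matrixP /(_ 0 0).
by rewrite !mxE.
Qed.

Lemma vnormB_le (w u v : V) : vnorm (u - v) <= vnorm (u - w) + vnorm (w - v).
Proof. by apply: le_trans (vnormD _ _); rewrite addrA subrK. Qed.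

Lemma mnorm_le_sum m n (A : 'M[V]_(m.+1, n.+1)) :
  mnorm A <= \sum_i \sum_j vnorm (A i j).
Proof. exact: (matrix_norm_le_sum (@mnormP R V)). Qed.

Lemma vnorm_le_mnorm m n (A : 'M[V]_(m.+1, n.+1)) i j :
  vnorm (A i j) <= mnorm A.
Proof. exact: (matrix_norm_entry (@mnormP R V)). Qed.

End VectorNormTheory.

(* The infimum and suprema below are taken in the extended reals, where they
   are total: cbnd phi = +oo when phi is not completely bounded. *)

Section CompletelyBounded.
Context {R : realType}.

(* cb_bound, completely_bounded and cbnd are the array-weighted notions, for
   arbitrary functions. The matrix-normed ones, for linear maps, are cb_norm and
   cb_linear, with amp_norm phi m n the operator norm of the amplification of
   phi to arrays of size m.+1 x n.+1. *)

Definition cb_bound (X Y : arrayWeightedSet R) (phi : X -> Y) (L : R) :=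
  0 <= L /\ forall m n (A : 'M[X]_(m.+1, n.+1)),
    aweight (map_mx phi A) <= L * aweight A.

Definition completely_bounded (X Y : arrayWeightedSet R) (phi : X -> Y) :=
  exists L, cb_bound phi L.

Definition cbnd (X Y : arrayWeightedSet R) (phi : X -> Y) : \bar R :=
  ereal_inf [set L%:E | L in [set L | cb_bound phi L]].

Definition completely_contractive (X Y : arrayWeightedSet R) (phi : X -> Y) :=
  (cbnd phi <= 1)%E.

Definition amp_norm (V W : matrixNormedSpace R) (phi : V -> W) m n : \bar R :=
  ereal_sup [set (mnorm (map_mx phi A))%:E |
             A in [set A : 'M[V]_(m.+1, n.+1) | mnorm A <= 1]].

Definition cb_norm (V W : matrixNormedSpace R) (phi : V -> W) : \bar R :=
  ereal_sup [set amp_norm phi mn.1 mn.2 | mn in [set: nat * nat]].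

Definition cb_linear (V W : matrixNormedSpace R) (phi : V -> W) :=
  (cb_norm phi < +oo)%E.

End CompletelyBounded.

Arguments cb_bound {R} X Y phi L.
Arguments completely_bounded {R} X Y phi.
Arguments cbnd {R} X Y phi.
Arguments completely_contractive {R} X Y phi.
Arguments cb_norm {R} V W phi.
Arguments cb_linear {R} V W phi.

Section CbTheory.
Context {R : realType} (X Y : arrayWeightedSet R).

Lemma completely_contractiveP (phi : X -> Y) :
  completely_contractive X Y phi <->
  forall m n (A : 'M[X]_(m.+1, n.+1)), aweight (map_mx phi A) <= aweight A.
Proof.
split=> [cc m n A|h]; last first.
  apply: ereal_inf_lbound; exists 1 => //=; split => // m n A.
  by rewrite mul1r.
have w0 := array_weight_ge0 (aweightP X) A.
apply/ler_addgt0Pr => e e0.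
have d0 : 0 < e / (aweight A + 1).
  by rewrite divr_gt0 // ltr_wpDl.
have [_ [L [L0 hL] <-]] : exists2 x, [set L%:E | L in [set L | cb_bound X Y phi L]] x
    & (x < (1 + e / (aweight A + 1))%:E)%E.
  by apply: ereal_inf_lt; apply: le_lt_trans cc _; rewrite lte_fin ltrDl.
rewrite lte_fin => /ltW hLe; apply: (le_trans (hL _ _ A)).
apply: (le_trans (ler_wpM2r w0 hLe)).
rewrite mulrDl mul1r lerD2l -mulrA ler_piMr //; first exact: ltW.
by rewrite mulrC ler_pdivrMr ?ltr_wpDl // mul1r lerDl.
Qed.

End CbTheory.

Lemma real_cauchy_cvg (R : realType) (u : nat -> R) :
  (forall e, 0 < e -> exists N, forall p q,
    (N <= p)%N -> (N <= q)%N -> `|u p - u q| < e) ->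
  cvg (u @ \oo).
Proof.
move=> h; apply/cauchy_cvgP; apply: cauchy_exP => e e0.
have [N hN] := h _ e0; exists (u N).
by exists N => // p /= Np; rewrite /ball /= hN.
Qed.

Lemma squeeze0 (R : realType) (u w : nat -> R) :
  (forall p, 0 <= u p <= w p) -> w @ \oo --> (0 : R) -> u @ \oo --> (0 : R).
Proof.
move=> uw w0; apply: (@squeeze_cvgr _ _ _ _ (fun=> 0) w) => //.
  by apply: nearW => p; exact: uw.
exact: cvg_cst.
Qed.

Lemma cvg_dist0 (R : realType) (u : nat -> R) (l : R) :
  u @ \oo --> l -> (fun p => `|u p - l|) @ \oo --> (0 : R).
Proof.
move=> ul; have := cvg_norm (cvgB ul (cvg_cst l)).
by rewrite subrr normr0; exact.
Qed.

Section MinimalC.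
Variable R : realType.
Local Notation C := R[i].

Lemma opnorm_matrix_norm :
  @matrix_norm R C^o (fun m n (A : 'M[C^o]_(m.+1, n.+1)) =>
    opnorm (A : 'M[C]_(m.+1, n.+1))).
Proof.
split.
- by move=> m n A; exact: opnorm_ge0.
- by move=> m n A /opnorm_eq0.
- move=> m n c A; rewrite -opnormZ; congr opnorm.
  by apply/matrixP => i j; rewrite !mxE.
- by move=> m n A B; exact: opnormD.
- move=> k m n l A B D.
  have -> : ractmx (lactmx A B) D = A *m (B : 'M[C]_(_, _)) *m D.
    apply/matrixP => i j; rewrite !mxE; apply: eq_bigr => p _.
    by rewrite !mxE mulrC.
  apply: (le_trans (opnormM _ _)).
  by rewrite ler_wpM2r ?opnorm_ge0 ?opnormM.
Qed.

(* MIN(C) *)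
Definition MINC : matrixNormedSpace R := MatrixNormedSpace opnorm_matrix_norm.

Lemma vnorm_MINC (z : MINC) : vnorm z = Normc.normc (z : C).
Proof. exact: opnorm_const11. Qed.

Lemma Re_le_normc (z : C) : `|complex.Re z| <= Normc.normc z.
Proof.
by case: z => a b /=; rewrite -sqrtr_sqr ler_sqrt ?addr_ge0 ?sqr_ge0 //
  lerDl sqr_ge0.
Qed.

Lemma Im_le_normc (z : C) : `|complex.Im z| <= Normc.normc z.
Proof.
by case: z => a b /=; rewrite -sqrtr_sqr ler_sqrt ?addr_ge0 ?sqr_ge0 //
  lerDr sqr_ge0.
Qed.

Lemma normc_le_ReIm (z : C) : Normc.normc z <= `|complex.Re z| + `|complex.Im z|.
Proof.
case: z => a b /=; rewrite -[leRHS]ger0_norm ?addr_ge0 // -sqrtr_sqr.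
rewrite ler_sqrt ?sqr_ge0 // sqrrD !real_normK ?num_real //.
by rewrite addrAC lerDl mulrn_wge0 // mulr_ge0.
Qed.

Lemma MINC_complete (u : nat -> MINC) : vcauchy u -> exists v, vcvg u v.
Proof.
move=> cu.
have cRe : cvg ((fun p => complex.Re (u p : C)) @ \oo).
  apply: real_cauchy_cvg => e /cu[N hN]; exists N => p q Np Nq.
  apply: le_lt_trans (hN p q Np Nq); rewrite vnorm_MINC.
  apply: le_trans (Re_le_normc _).
  by case: (u p) (u q) => [a b] [c d].
have cIm : cvg ((fun p => complex.Im (u p : C)) @ \oo).
  apply: real_cauchy_cvg => e /cu[N hN]; exists N => p q Np Nq.
  apply: le_lt_trans (hN p q Np Nq); rewrite vnorm_MINC.
  apply: le_trans (Im_le_normc _).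
  by case: (u p) (u q) => [a b] [c d].
set a := lim ((fun p => complex.Re (u p : C)) @ \oo) in cRe.
set b := lim ((fun p => complex.Im (u p : C)) @ \oo) in cIm.
exists (Complex a b : C); rewrite /vcvg.
have z : (fun p => `|complex.Re (u p : C) - a| + `|complex.Im (u p : C) - b|) @ \oo --> (0:R).
  by have := cvgD (cvg_dist0 cRe) (cvg_dist0 cIm); rewrite addr0; exact.
apply: (squeeze0 _ z) => p; rewrite vnorm_ge0 andTb vnorm_MINC.
apply: (le_trans (normc_le_ReIm _)).
by case: (u p) => c d.
Qed.

Definition MINC_banach : matBanachSpace R := MatBanachSpace MINC_complete.

End MinimalC.

Section LinearQuotient.
Variables (K : nzRingType) (V : lmodType K) (I : submodClosed V).
Local Open Scope quotient_scope.

Definition lquot_pred : {pred V} := fun v => v \in I.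
HB.instance Definition _ := GRing.isZmodClosed.Build V lquot_pred
  (GRing.submod_closedB (submodClosedP I)).

Definition lquot := Quotient.quot lquot_pred.
HB.instance Definition _ := GRing.Zmodule.on lquot.

Definition lquot_pi (v : V) : lquot := \pi_(Quotient.quot lquot_pred) v.
Definition lquot_repr (x : lquot) : V := repr (x : Quotient.quot lquot_pred).

Lemma lquot_reprK : cancel lquot_repr lquot_pi.
Proof. by move=> x; rewrite /lquot_pi reprK. Qed.

Lemma lquot_piP (u v : V) : lquot_pi u = lquot_pi v <-> u - v \in I.
Proof.
rewrite -[u - v \in I]/(u - v \in lquot_pred) Quotient.idealrBE.
by split => [/eqP|/eqP].
Qed.

Lemma lquot_piB : {morph lquot_pi : u v / u - v}.
Proof. exact: (raddfB (\pi_(Quotient.quot lquot_pred))). Qed.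

Lemma lquot_piD : {morph lquot_pi : u v / u + v}.
Proof. exact: (raddfD (\pi_(Quotient.quot lquot_pred))). Qed.

Definition lquot_scale (c : K) (x : lquot) : lquot :=
  lquot_pi (c *: lquot_repr x).

Lemma lquot_scale_pi c v : lquot_scale c (lquot_pi v) = lquot_pi (c *: v).
Proof.
apply/lquot_piP; rewrite -scalerBr rpredZ //.
by apply/lquot_piP; rewrite lquot_reprK.
Qed.

Lemma lquot_scaleA a b x :
  lquot_scale a (lquot_scale b x) = lquot_scale (a * b) x.
Proof. by rewrite -(lquot_reprK x) !lquot_scale_pi scalerA. Qed.
Lemma lquot_scale1 : left_id 1 lquot_scale.
Proof. by move=> x; rewrite -(lquot_reprK x) !lquot_scale_pi scale1r. Qed.
Lemma lquot_scaleDr : right_distributive lquot_scale +%R.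
Proof.
move=> c x y; rewrite -(lquot_reprK x) -(lquot_reprK y) -lquot_piD.
by rewrite !lquot_scale_pi scalerDr lquot_piD.
Qed.
Lemma lquot_scaleDl x : {morph lquot_scale^~ x : a b / a + b}.
Proof.
move=> a b; rewrite -(lquot_reprK x) !lquot_scale_pi scalerDl.
by rewrite lquot_piD.
Qed.

HB.instance Definition _ := GRing.Zmodule_isLmodule.Build K lquot
  lquot_scaleA lquot_scale1 lquot_scaleDr lquot_scaleDl.

Lemma lquot_pi_linear : linear lquot_pi.
Proof. by move=> c u v; rewrite lquot_piD -lquot_scale_pi. Qed.
HB.instance Definition _ := GRing.isLinear.Build K V lquot _ lquot_pi
  lquot_pi_linear.

Section Lift.
Variables (W : lmodType K) (f : {linear V -> W}).
Hypothesis f0 : forall v, v \in I -> f v = 0.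

Definition lquot_lift_fun (x : lquot) : W := f (lquot_repr x).

Lemma lquot_lift_fun_pi v : lquot_lift_fun (lquot_pi v) = f v.
Proof.
apply/eqP; rewrite -subr_eq0 -linearB; apply/eqP/f0.
by apply/lquot_piP; rewrite lquot_reprK.
Qed.

Lemma lquot_lift_linear : linear lquot_lift_fun.
Proof.
move=> c x y; rewrite -(lquot_reprK x) -(lquot_reprK y) -linearP.
by rewrite !lquot_lift_fun_pi linearP.
Qed.

Lemma lquot_lift : exists g : {linear lquot -> W},
  forall v, g (lquot_pi v) = f v.
Proof.
pose m := GRing.isLinear.Build K lquot W _ lquot_lift_fun lquot_lift_linear.
pose g : {linear lquot -> W} := HB.pack lquot_lift_fun m.
by exists g; exact: lquot_lift_fun_pi.
Qed.

End Lift.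
End LinearQuotient.

Section FreeMatricialSpace.
Context {R : realType}.
Variable X : arrayWeightedSet R.
Local Notation C := R[i].

(* {classic X} is X with the choice structure required by the free module *)
Definition freeV : lmodType C := {freeg {classic X} / C}.

Definition theta (x : X) : freeV := << (x : {classic X}) >>.

(* nullV, quotV, qnorm and QX are N_X, Q_X, its norms, and Q_X with them *)
Definition nullV : {pred freeV} := fun v =>
  `[< forall phi : {linear freeV -> MINC R},
        completely_contractive X (MINC R) (phi \o theta) -> phi v = 0 >].

Lemma nullV_closed : submod_closed nullV.
Proof.
split; first by apply/asboolP => phi _; rewrite linear0.
move=> c u v /asboolP hu /asboolP hv; apply/asboolP => phi cc.
by rewrite linearP hu // hv // scaler0 addr0.
Qed.
HB.instance Definition _ := GRing.isSubmodClosed.Build C freeV nullV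
  (GRing.submod_closed_semi nullV_closed).

Definition quotV : lmodType C := lquot nullV.

Definition quot_map : {linear freeV -> quotV} := @lquot_pi C freeV nullV.

(* The set of reals is nonempty and bounded above: see qnorm_has_sup. *)
Definition qnorm m n (A : 'M[quotV]_(m.+1, n.+1)) : R :=
  sup [set r : R | exists (W : matBanachSpace R) (phi : {linear quotV -> W}),
    completely_contractive X W (phi \o quot_map \o theta) /\
    r = mnorm (map_mx phi A)].

Lemma freeV_sumE (v : freeV) :
  v = \sum_(x <- dom v) coeff x v *: theta x.
Proof.
rewrite -[LHS]freeg_sumE; apply: eq_bigr => x _.
by apply/eqP/freeg_eqP => y; rewrite coeffZ !coeffU mul1r.
Qed.

Lemma aweight_const (W : matrixNormedSpace R) (phi : X -> W) x :
  completely_contractive X W phi ->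
  vnorm (phi x) <= aweight (const_mx x : 'M[X]_(1, 1)).
Proof.
move=> /completely_contractiveP /(_ 0 0 (const_mx x : 'M[X]_(1, 1))).
apply: le_trans; rewrite /= /vnorm (_ : map_mx _ _ = const_mx (phi x)) //.
by apply/matrixP => i j; rewrite !mxE.
Qed.

Lemma quotV_bound (v : quotV) : exists M : R,
  forall (W : matBanachSpace R) (phi : {linear quotV -> W}),
    completely_contractive X W (phi \o quot_map \o theta) -> vnorm (phi v) <= M.
Proof.
set u : freeV := lquot_repr v.
exists (\sum_(x <- dom u) Normc.normc (coeff x u) *
  aweight (const_mx (x : X) : 'M[X]_(1, 1))) => W phi cc.
have -> : v = quot_map u by rewrite /quot_map /= lquot_reprK.
rewrite [in leLHS](freeV_sumE u) !linear_sum /=.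
elim/big_ind2: _ => [|a b a' b' ha hb|x _]; first by rewrite vnorm0.
  by apply: (le_trans (vnormD _ _)); exact: lerD.
rewrite !linearZ vnormZ ler_wpM2l ?normc_ge0 //.
exact: (aweight_const x cc).
Qed.

Lemma quotV_mbound m n (A : 'M[quotV]_(m.+1, n.+1)) : exists M : R,
  forall (W : matBanachSpace R) (phi : {linear quotV -> W}),
    completely_contractive X W (phi \o quot_map \o theta) ->
    mnorm (map_mx phi A) <= M.
Proof.
have /choice[b hb] := quotV_bound.
exists (\sum_i \sum_j b (A i j)) => W phi cc.
apply: (le_trans (mnorm_le_sum _)); apply: ler_sum => i _.
by apply: ler_sum => j _; rewrite mxE hb.
Qed.

Lemma cc_zero (W : matBanachSpace R) :
  completely_contractive X W ((\0 : quotV -> W) \o quot_map \o theta).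
Proof.
apply/completely_contractiveP => m n A.
rewrite (_ : map_mx _ _ = 0) /=; last by apply/matrixP => i j; rewrite !mxE.
by rewrite (matrix_norm0 (@mnormP R W)) (array_weight_ge0 (aweightP X)).
Qed.

Lemma qnorm_has_sup m n (A : 'M[quotV]_(m.+1, n.+1)) :
  has_sup [set r : R | exists (W : matBanachSpace R)
    (phi : {linear quotV -> W}),
    completely_contractive X W (phi \o quot_map \o theta) /\
    r = mnorm (map_mx phi A)].
Proof.
split.
  by eexists; exists (MINC_banach R), \0; split => //; exact: cc_zero.
by have [M hM] := quotV_mbound A; exists M => _ [W [phi [cc ->]]]; exact: hM.
Qed.

Lemma qnorm_ub m n (A : 'M[quotV]_(m.+1, n.+1)) (W : matBanachSpace R)
    (phi : {linear quotV -> W}) :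
  completely_contractive X W (phi \o quot_map \o theta) ->
  mnorm (map_mx phi A) <= qnorm A.
Proof.
move=> cc; apply: sup_upper_bound; first exact: qnorm_has_sup.
by exists W, phi.
Qed.

Lemma qnorm_le m n (A : 'M[quotV]_(m.+1, n.+1)) M :
  (forall (W : matBanachSpace R) (phi : {linear quotV -> W}),
    completely_contractive X W (phi \o quot_map \o theta) ->
    mnorm (map_mx phi A) <= M) ->
  qnorm A <= M.
Proof.
move=> h; apply: ge_sup; first exact: (qnorm_has_sup A).1.
by move=> _ [W [phi [cc ->]]]; exact: h.
Qed.

Lemma qnorm_ge0 m n (A : 'M[quotV]_(m.+1, n.+1)) : 0 <= qnorm A.
Proof.
apply: le_trans (qnorm_ub A (@cc_zero (MINC_banach R))).
exact: (matrix_norm_ge0 (@mnormP _ _)).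
Qed.

Lemma quotV_sep (v : quotV) : v != 0 ->
  exists phi : {linear quotV -> MINC_banach R},
    completely_contractive X (MINC_banach R) (phi \o quot_map \o theta) /\
    phi v != 0.
Proof.
rewrite -{1}(lquot_reprK v) => v0.
have /asboolPn /existsNP[phi /not_implyP[cc /eqP phiv]] :
    lquot_repr v \notin nullV.
  apply: contra v0 => h; apply/eqP; rewrite -(linear0 quot_map).
  by apply/lquot_piP; rewrite subr0.
have [|g gE] := @lquot_lift C freeV nullV (MINC R) phi.
  by move=> u /asboolP; exact.
exists g; split; last by rewrite -(lquot_reprK v) gE.
by rewrite (_ : _ \o _ = phi \o theta) //; apply/funext => x /=; rewrite gE.
Qed.

Lemma qnorm_matrix_norm : matrix_norm qnorm.
Proof.
split.
- exact: qnorm_ge0.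
- move=> m n A A0; apply/matrixP => i j; rewrite mxE; apply/eqP.
  apply: contraTT isT => /quotV_sep[phi [cc]] /eqP; case.
  apply: vnorm_eq0; apply/le_anti; rewrite vnorm_ge0 andbT -A0.
  apply: le_trans (qnorm_ub A cc).
  have := vnorm_le_mnorm (map_mx phi A) i j.
  by rewrite mxE.
- have le m n (c : C) (A : 'M[quotV]_(m.+1, n.+1)) :
      qnorm (map_mx ( *:%R c) A) <= Normc.normc c * qnorm A.
    apply: qnorm_le => W phi cc; rewrite map_mxlin_scale.
    rewrite (matrix_normZ (@mnormP _ _)) ler_wpM2l ?normc_ge0 //.
    exact: qnorm_ub.
  move=> m n c A; apply/le_anti; rewrite le /=.
  have [->|c0] := eqVneq c 0; first by rewrite normc_0 mul0r qnorm_ge0.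
  have nc0 : 0 < Normc.normc c.
    rewrite lt_def normc_ge0 andbT; apply: contraNneq c0 => h.
    by rewrite (Normc.eq0_normc h).
  rewrite -ler_pdivlMl // -Normc.normcV; apply: le_trans (le _ _ _ _).
  rewrite (_ : map_mx _ (map_mx _ A) = A) //.
  by apply/matrixP => i j; rewrite !mxE scalerA mulVf // scale1r.
- move=> m n A B; apply: qnorm_le => W phi cc.
  rewrite (_ : map_mx phi (A + B) = map_mx phi A + map_mx phi B); last first.
    by apply/matrixP => i j; rewrite !mxE linearD.
  apply: (le_trans (matrix_normD (@mnormP _ _) _ _)).
  by apply: lerD; exact: qnorm_ub.
- move=> k m n l A B D; apply: qnorm_le => W phi cc.
  rewrite map_ractmx map_lactmx.
  apply: (le_trans (matrix_norm_act (@mnormP _ _) _ _ _)).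
  rewrite ler_wpM2r ?opnorm_ge0 // ler_wpM2l ?opnorm_ge0 //.
  exact: qnorm_ub.
Qed.

Definition QX : matrixNormedSpace R := MatrixNormedSpace qnorm_matrix_norm.

End FreeMatricialSpace.

Section Completion.
Context {R : realType}.
Variable V : matrixNormedSpace R.
Local Notation C := R[i].

Definition cauchy_pred : {pred nat -> V} := fun u => `[< vcauchy u >].

Lemma cauchy_pred_closed : submod_closed cauchy_pred.
Proof.
split.
  apply/asboolP => e e0; exists 0%N => p q _ _ /=.
  by rewrite subrr vnorm0.
move=> c u v /asboolP hu /asboolP hv; apply/asboolP => e e0.
have d0 : 0 < e / 2 / (Normc.normc c + 1).
  by rewrite !divr_gt0 // ltr_wpDl // normc_ge0.
have [N1 h1] := hu _ d0.
have [|N2 h2] := hv (e / 2); first by rewrite divr_gt0.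
exists (maxn N1 N2) => p q; rewrite !geq_max => /andP[p1 p2] /andP[q1 q2].
rewrite (_ : _ - _ = c *: (u p - u q) + (v p - v q)); last first.
  by rewrite scalerBr opprD addrACA.
apply: (le_lt_trans (vnormD _ _)); rewrite (splitr e); apply: ltr_leD.
  rewrite vnormZ (le_lt_trans (y := (Normc.normc c + 1) * vnorm (u p - u q))) //.
    by rewrite ler_wpM2r ?vnorm_ge0 // lerDl.
  rewrite mulrC -ltr_pdivlMr ?h1 //.
  by rewrite ltr_wpDl // normc_ge0.
by rewrite ltW // h2.
Qed.
HB.instance Definition _ := GRing.isSubmodClosed.Build C (nat -> V) cauchy_pred
  (GRing.submod_closed_semi cauchy_pred_closed).

Record cauchySeq := CauchySeq {
  cauchy_fun : nat -> V;
  cauchy_funP : cauchy_fun \in cauchy_pred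
}.
HB.instance Definition _ := [isSub for cauchy_fun].
HB.instance Definition _ := [Choice of cauchySeq by <:].
HB.instance Definition _ := [SubChoice_isSubLmodule of cauchySeq by <:].

Lemma cauchySeqP (u : cauchySeq) : vcauchy (cauchy_fun u).
Proof. by case: u => u /= /asboolP. Qed.

Definition cauchy_at (p : nat) (u : cauchySeq) : V := cauchy_fun u p.

Lemma cauchy_at_linear p : linear (cauchy_at p).
Proof. by []. Qed.
HB.instance Definition _ p := GRing.isLinear.Build C cauchySeq V _ (cauchy_at p)
  (cauchy_at_linear p).

Definition null_pred : {pred cauchySeq} := fun u => `[< vcvg (cauchy_fun u) 0 >].

Lemma null_predP (u : cauchySeq) :
  reflect ((fun p => vnorm (cauchy_at p u)) @ \oo --> (0 : R))
          (u \in null_pred).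
Proof.
rewrite (_ : (fun p => vnorm (cauchy_at p u)) =
  (fun p => vnorm (cauchy_fun u p - 0))); first exact: asboolP.
by apply/funext => p; rewrite subr0.
Qed.

Lemma null_pred_closed : submod_closed null_pred.
Proof.
split.
  apply/null_predP; rewrite (_ : (fun _ => _) = fun=> 0); first exact: cvg_cst.
  by apply/funext => p; rewrite linear0 vnorm0.
move=> c u v /null_predP hu /null_predP hv; apply/null_predP.
have z : (fun p => Normc.normc c * vnorm (cauchy_at p u) +
    vnorm (cauchy_at p v)) @ \oo --> (0 : R).
  have := cvgD (cvgM (cvg_cst (Normc.normc c)) hu) hv.
  by rewrite mulr0 addr0; exact.
 apply: (squeeze0 _ z) => p.
by rewrite vnorm_ge0 linearP -vnormZ vnormD.
Qed.
HB.instance Definition _ := GRing.isSubmodClosed.Build C cauchySeq null_pred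
  (GRing.submod_closed_semi null_pred_closed).

Definition complV : lmodType C := lquot null_pred.

Definition complV_pi : {linear cauchySeq -> complV} :=
  @lquot_pi C cauchySeq null_pred.
Definition complV_repr (x : complV) : cauchySeq := lquot_repr x.

Lemma const_cauchy (v : V) : (fun=> v) \in cauchy_pred.
Proof.
by apply/asboolP => e e0; exists 0%N => p q _ _; rewrite subrr vnorm0.
Qed.

Definition kappa_fun (v : V) : complV := complV_pi (CauchySeq (const_cauchy v)).

(* The completion is the space of Cauchy sequences modulo null sequences. The
   limit below exists by cauchy_mnorm; by compl_norm_lim it can be computed along
   any sequence of arrays over V that converges entrywise to A. *)
Definition compl_norm m n (A : 'M[complV]_(m.+1, n.+1)) : R :=
  lim ((fun p => mnorm (map_mx (fun x => cauchy_at p (complV_repr x)) A)) @ \oo).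

Lemma cvg_sum0 (I : Type) (r : seq I) (F : I -> nat -> R) :
  (forall i, F i @ \oo --> (0 : R)) ->
  (fun p => \sum_(i <- r) F i p) @ \oo --> (0 : R).
Proof.
move=> h; elim: r => [|a r IH].
  by under eq_fun do rewrite big_nil; exact: cvg_cst.
under eq_fun do rewrite big_cons.
by have := cvgD (h a) IH; rewrite addr0; exact.
Qed.

Arguments cvg_sum0 [I] r [F] _.

Lemma cauchy_mnorm m n (U : 'M[cauchySeq]_(m.+1, n.+1)) :
  cvg ((fun p => mnorm (map_mx (cauchy_at p) U)) @ \oo).
Proof.
apply: real_cauchy_cvg => e e0.
have d0 : 0 < e / (m.+1 * n.+1)%:R by rewrite divr_gt0 // ltr0n.
have h i j : exists N, forall p q, (N <= p)%N -> (N <= q)%N ->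
    vnorm (cauchy_at p (U i j) - cauchy_at q (U i j)) < e / (m.+1 * n.+1)%:R.
  by have := cauchySeqP (U i j); apply.
have /choice[N hN] : forall ij, exists N, forall p q, (N <= p)%N -> (N <= q)%N ->
    vnorm (cauchy_at p (U ij.1 ij.2) - cauchy_at q (U ij.1 ij.2)) <
    e / (m.+1 * n.+1)%:R by move=> [i j]; exact: h.
exists (\max_ij N ij) => p q Np Nq.
apply: (le_lt_trans (matrix_norm_distB (@mnormP _ _) _ _)).
apply: (le_lt_trans (mnorm_le_sum _)).
rewrite (@lt_le_trans _ _ (\sum_(i < m.+1) \sum_(j < n.+1) e / (m.+1 * n.+1)%:R))//.
  apply: ltr_sum => [|i _]; first by apply/hasP; exists ord0; rewrite ?mem_index_enum.
  apply: ltr_sum => [|j _]; first by apply/hasP; exists ord0; rewrite ?mem_index_enum.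
  rewrite !mxE (hN (i, j)) //.
    by apply: leq_trans Np; exact: leq_bigmax.
  by apply: leq_trans Nq; exact: leq_bigmax.
rewrite !sumr_const !card_ord -mulrnA (mulnC n.+1 m.+1) -[leLHS]mulr_natr mulfVK //.
Qed.

Arguments cauchy_mnorm [m n] U.

Lemma mnorm_null m n (U W : 'M[cauchySeq]_(m.+1, n.+1)) :
  (forall i j, U i j - W i j \in null_pred) ->
  (fun p => mnorm (map_mx (cauchy_at p) U) - mnorm (map_mx (cauchy_at p) W))
    @ \oo --> (0 : R).
Proof.
move=> h; apply/norm_cvg0P.
have z : (fun p => \sum_i \sum_j vnorm (cauchy_at p (U i j - W i j)))
    @ \oo --> (0 : R).
  apply: cvg_sum0 => i; apply: cvg_sum0 => j.
  by apply/null_predP; exact: h.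
apply: (squeeze0 _ z) => p; rewrite normr_ge0 /=.
apply: (le_trans (matrix_norm_distB (@mnormP _ _) _ _)).
apply: (le_trans (mnorm_le_sum _)).
apply: ler_sum => i _; apply: ler_sum => j _.
by rewrite !mxE.
Qed.

Lemma compl_normE m n (U : 'M[cauchySeq]_(m.+1, n.+1)) :
  (fun p => mnorm (map_mx (cauchy_at p) U)) @ \oo -->
  compl_norm (map_mx complV_pi U).
Proof.
pose W := map_mx complV_repr (map_mx complV_pi U).
have E : compl_norm (map_mx complV_pi U) =
    lim ((fun p => mnorm (map_mx (cauchy_at p) W)) @ \oo).
  rewrite /compl_norm (_ : (fun p => mnorm (map_mx (cauchy_at p) W)) = fun p =>
    mnorm (map_mx (fun x => cauchy_at p (complV_repr x)) (map_mx complV_pi U))) //.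
  apply/funext => p; congr mnorm.
  by apply/matrixP => i j; rewrite !mxE.
rewrite E.
have UW i j : U i j - W i j \in null_pred.
  by apply/lquot_piP; rewrite !mxE lquot_reprK.
have := cvgD (mnorm_null UW) (cauchy_mnorm W); rewrite add0r.
suff -> : (fun p => mnorm (map_mx (cauchy_at p) U)) = (fun p =>
    (mnorm (map_mx (cauchy_at p) U) - mnorm (map_mx (cauchy_at p) W)) +
    mnorm (map_mx (cauchy_at p) W)) by exact.
by apply/funext => p; rewrite subrK.
Qed.

Arguments compl_normE [m n] U.

Lemma complV_mxP m n (A : 'M[complV]_(m, n)) :
  A = map_mx complV_pi (map_mx complV_repr A).
Proof. by apply/matrixP => i j; rewrite !mxE /= lquot_reprK. Qed.

Lemma compl_norm_le m n (U : 'M[cauchySeq]_(m.+1, n.+1)) M :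
  (exists N, forall p, (N <= p)%N -> mnorm (map_mx (cauchy_at p) U) <= M) ->
  compl_norm (map_mx complV_pi U) <= M.
Proof.
move=> [N hN]; apply: (cvgr_to_le (compl_normE U)).
by exists N => // p; exact: hN.
Qed.

Lemma compl_norm_ge0 m n (A : 'M[complV]_(m.+1, n.+1)) : 0 <= compl_norm A.
Proof.
rewrite (complV_mxP A); apply: (cvgr_to_ge (compl_normE _)).
by apply: nearW => p; exact: (matrix_norm_ge0 (@mnormP _ _)).
Qed.

Lemma compl_matrix_norm : matrix_norm compl_norm.
Proof.
split.
- exact: compl_norm_ge0.
- move=> m n A A0; rewrite (complV_mxP A); apply/matrixP => i j.
  rewrite !mxE -(linear0 complV_pi); apply/lquot_piP; rewrite subr0.
  apply/null_predP.
  have := compl_normE (map_mx complV_repr A); rewrite -complV_mxP A0.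
  move=> z; apply: (squeeze0 _ z) => p; rewrite vnorm_ge0 andTb.
  have := vnorm_le_mnorm (map_mx (cauchy_at p) (map_mx complV_repr A)) i j.
  by rewrite !mxE.
- move=> m n c A; rewrite (complV_mxP A) -map_mxlin_scale.
  set U := map_mx complV_repr A.
  apply: (cvg_unique _ (compl_normE (map_mx ( *:%R c) U))).
    exact: norm_hausdorff.
  have -> : (fun p => mnorm (map_mx (cauchy_at p) (map_mx ( *:%R c) U))) =
      (fun p => Normc.normc c * mnorm (map_mx (cauchy_at p) U)).
    apply/funext => p; rewrite -(matrix_normZ (@mnormP _ _)); congr mnorm.
    by apply/matrixP => i j; rewrite !mxE.
  by apply: cvgM; [exact: cvg_cst | exact: compl_normE].
- move=> m n A B; rewrite (complV_mxP A) (complV_mxP B).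
  set U := map_mx complV_repr A; set W := map_mx complV_repr B.
  have -> : map_mx complV_pi U + map_mx complV_pi W = map_mx complV_pi (U + W).
    by apply/matrixP => i j; rewrite !mxE linearD.
  apply: (ler_cvg_to (compl_normE _) (cvgD (compl_normE _) (compl_normE _))).
  apply: nearW => p /=; rewrite (_ : map_mx _ _ =
    map_mx (cauchy_at p) U + map_mx (cauchy_at p) W).
    exact: (matrix_normD (@mnormP _ _)).
  by apply/matrixP => i j; rewrite !mxE linearD.
- move=> k m n l A B D; rewrite (complV_mxP B) -map_lactmx -map_ractmx.
  set U := map_mx complV_repr B.
  have h : (fun p => opnorm A * mnorm (map_mx (cauchy_at p) U) * opnorm D)
      @ \oo --> opnorm A * compl_norm (map_mx complV_pi U) * opnorm D.
    apply: cvgM; last exact: cvg_cst.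
    by apply: cvgM; [exact: cvg_cst | exact: compl_normE].
  apply: (ler_cvg_to (compl_normE _) h).
  apply: nearW => p; rewrite map_ractmx map_lactmx.
  exact: (matrix_norm_act (@mnormP _ _)).
Qed.

Definition complMN : matrixNormedSpace R := MatrixNormedSpace compl_matrix_norm.

Lemma kappa_linear : linear kappa_fun.
Proof.
move=> c u v; rewrite /kappa_fun -linearP; congr (complV_pi _).
exact/val_inj.
Qed.
HB.instance Definition _ := GRing.isLinear.Build C V complV _ kappa_fun
  kappa_linear.

Definition kappa : {linear V -> complMN} := kappa_fun.

Lemma kappa_isometry m n (A : 'M[V]_(m.+1, n.+1)) :
  mnorm (map_mx kappa A) = mnorm A.
Proof.
rewrite (_ : map_mx kappa A =
  map_mx complV_pi (map_mx (fun v => CauchySeq (const_cauchy v)) A)); last first.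
  by apply/matrixP => i j; rewrite !mxE.
apply: (cvg_unique _ (compl_normE _)); first exact: norm_hausdorff.
rewrite (_ : (fun _ => _) = fun=> mnorm A); first exact: cvg_cst.
by apply/funext => p; congr mnorm; apply/matrixP => i j; rewrite !mxE.
Qed.

Lemma vnorm_kappa (v : V) : vnorm (kappa v) = vnorm v.
Proof.
rewrite /vnorm -(kappa_isometry (const_mx v)); congr mnorm.
by apply/matrixP => i j; rewrite !mxE.
Qed.

Lemma vnorm_complE (u : cauchySeq) :
  (fun p => vnorm (cauchy_at p u)) @ \oo --> vnorm (complV_pi u : complMN).
Proof.
have := compl_normE (const_mx u : 'M_(1, 1)).
rewrite (_ : map_mx _ _ = const_mx (complV_pi u)); last first.
  by apply/matrixP => i j; rewrite !mxE.
under eq_fun => p.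
  rewrite (_ : map_mx _ _ = const_mx (cauchy_at p u)); last first.
    by apply/matrixP => i j; rewrite !mxE.
  over.
exact.
Qed.

Arguments vnorm_complE u : clear implicits.

Lemma kappa_dense (x : complMN) e : 0 < e ->
  exists v : V, vnorm (x - kappa v) <= e.
Proof.
move=> e0; pose u := complV_repr x.
have [N hN] := cauchySeqP u e0.
exists (cauchy_at N u).
rewrite -(lquot_reprK x) -/(complV_repr x) -/u.
pose w : cauchySeq := u - CauchySeq (const_cauchy (cauchy_at N u)).
rewrite (_ : _ - _ = complV_pi w); last by rewrite /w linearB.
apply: (cvgr_to_le (vnorm_complE w)).
exists N => // p Np; apply/ltW; exact: hN.
Qed.

Lemma compl_complete (a : nat -> complMN) : vcauchy a -> exists x, vcvg a x.
Proof.
move=> ca.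
have /choice[v hv] : forall p, exists v : V, vnorm (a p - kappa v) <= p.+1%:R^-1.
  by move=> p; apply: kappa_dense; rewrite invr_gt0 ltr0n.
have inv0 e : 0 < e -> exists N, forall p, (N <= p)%N -> p.+1%:R^-1 < e :> R.
  move=> e0; have := @cvg_harmonic R => /cvgr0Pnorm_lt /(_ e e0)[N _ hN].
  exists N => p Np; have := hN p Np.
  by rewrite /= ger0_norm // invr_ge0.
have cv : v \in cauchy_pred.
  apply/asboolP => e e0; have e3 : 0 < e / 3 by rewrite divr_gt0.
  have [N1 h1] := ca _ e3; have [N2 h2] := inv0 _ e3.
  exists (maxn N1 N2) => p q; rewrite !geq_max => /andP[p1 p2] /andP[q1 q2].
  rewrite -vnorm_kappa linearB (le_lt_trans (vnormB_le (a p) _ _)) //.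
  apply: (@le_lt_trans _ _ (vnorm (kappa (v p) - a p) +
     (vnorm (a p - a q) + vnorm (a q - kappa (v q))))).
    by rewrite lerD2l vnormB_le.
  rewrite (_ : e = e / 3 + (e / 3 + e / 3)); last by field.
  apply: ltrD; last apply: ltrD.
  - by rewrite vnormBC (le_lt_trans (hv p)) ?h2.
  - exact: h1.
  - by rewrite (le_lt_trans (hv q)) ?h2.
exists (complV_pi (CauchySeq cv)); apply/cvgr0Pnorm_le => e e0.
have e2 : 0 < e / 2 by rewrite divr_gt0.
have /asboolP/(_ _ e2)[N1 h1] := cv; have [N2 h2] := inv0 _ e2.
exists (maxn N1 N2) => // p p12.
have /andP[p1 p2] : (N1 <= p)%N && (N2 <= p)%N by rewrite -geq_max.
rewrite ger0_norm ?vnorm_ge0 //.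
apply: (le_trans (vnormB_le (kappa (v p)) _ _)).
rewrite (splitr e) lerD //; first by rewrite (le_trans (hv p)) // ltW ?h2.
rewrite (_ : _ - _ = complV_pi (CauchySeq (const_cauchy (v p)) - CauchySeq cv));
  last by rewrite linearB.
apply: (cvgr_to_le (vnorm_complE _)); exists N1 => // q Nq /=.
by apply/ltW; exact: h1.
Qed.

Definition completion : matBanachSpace R := MatBanachSpace compl_complete.

Lemma compl_norm_lim m n (A : 'M[completion]_(m.+1, n.+1))
    (B : nat -> 'M[V]_(m.+1, n.+1)) :
  (forall i j, vcvg (fun p => kappa (B p i j) : completion) (A i j)) ->
  (fun p => mnorm (B p)) @ \oo --> mnorm A.
Proof.
move=> BA; apply/subr_cvg0/norm_cvg0P.
have z : (fun p => \sum_i \sum_j vnorm (kappa (B p i j) - A i j))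
    @ \oo --> (0 : R).
  by apply: cvg_sum0 => i; apply: cvg_sum0 => j; exact: BA.
apply: (squeeze0 _ z) => p; rewrite normr_ge0 andTb -kappa_isometry.
apply: (le_trans (matrix_norm_distB (@mnormP _ _) _ _)).
apply: (le_trans (mnorm_le_sum _)).
by apply: ler_sum => i _; apply: ler_sum => j _; rewrite !mxE.
Qed.

End Completion.

Section MBanSp.
Context {R : realType}.
Variable X : arrayWeightedSet R.

Definition MBanSp : matBanachSpace R := completion (QX X).

Definition eta (x : X) : MBanSp := kappa (QX X) (quot_map X (theta x)).

End MBanSp.

Arguments eta {R} X x.

(* Main.v *)
(** The free extension of [phi] to V_X kills N_X: by Hahn-Banach the bounded
    functionals separate the points of W, and every functional of norm at most 1
    is completely contractive into MIN(C). The induced map on Q_X satisfies every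
    bound L of [phi], since rescaling it by M > L makes it one of the maps in the
    supremum that defines the norms of Q_X. It then extends to the completion by
    continuity, and density of Q_X gives uniqueness. *)

From HB Require Import structures.
From mathcomp Require Import topology normedtype sequences freeg ring.
Require Import Defs.
From mathcomp Require Import all_boot all_order all_algebra.
From mathcomp Require Import all_classical all_reals ereal.
From mathcomp Require Import complex.

Set Implicit Arguments.
Unset Strict Implicit.
Unset Printing Implicit Defensive.

Import Order.TTheory GRing.Theory Num.Theory.
Import numFieldNormedType.Exports.

Local Open Scope classical_set_scope.
Local Open Scope ring_scope.

(** * Hahn-Banach by minimal sublinear maps *)

Section HahnBanach.
Context {R : realType} {V : lmodType R[i]}.
Implicit Types (p q : V -> R) (x y : V).
Local Notation "t %:C" := (real_complex R t).

(** Homogeneity is only an inequality, which is easier to check for infima; equality follows by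
    applying it to [t^-1] as well. *)
Definition sublinear q :=
  (forall x y, q (x + y) <= q x + q y) /\
  (forall t x, 0 <= t -> q (t%:C *: x) <= t * q x).

Lemma sublinear0 q : sublinear q -> q 0 = 0.
Proof.
move=> [qD qZ]; apply/le_anti/andP; split.
  by have := qZ 0 0 (lexx _); rewrite scaler0 mul0r.
by have := qD 0 0; rewrite addr0 lerDl.
Qed.

Lemma sublinearZ q t x : sublinear q -> 0 <= t -> q (t%:C *: x) = t * q x.
Proof.
move=> sq t0; apply/le_anti; rewrite sq.2 //=.
have [->|tn0] := eqVneq t 0; first by rewrite mul0r scale0r sublinear0.
have tp : 0 < t by rewrite lt_def tn0.
rewrite -ler_pdivlMl //; have := sq.2 t^-1 (t%:C *: x).
rewrite invr_ge0 scalerA -rmorphM mulVf // scale1r; exact.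
Qed.

Lemma sublinear_opp q x : sublinear q -> - q (- x) <= q x.
Proof.
move=> sq; have := sq.1 x (- x).
by rewrite subrr (sublinear0 sq) -lerBlDr sub0r.
Qed.

(** For sublinear [q], this is the largest sublinear map below [q] whose value at [- y] is at most
    [- q y]. *)
Definition lowering q y x : R :=
  inf [set q (x + t%:C *: y) - t * q y | t in [set t | 0 <= t]].

Lemma lowering_le q y x t : sublinear q -> 0 <= t ->
  lowering q y x <= q (x + t%:C *: y) - t * q y.
Proof.
move=> sq t0; apply: ge_inf; last by exists t.
(* The infimum is a genuine one: [s * q y = q (s y) <= q (x + s y) + q (- x)]. *)
exists (- q (- x)) => _ [s s0 <-]; rewrite -(sublinearZ y sq s0) lerBrDr addrC.
rewrite lerBlDr; apply: le_trans (sq.1 _ _).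
by rewrite addrAC subrr add0r.
Qed.

Lemma le_lowering q y x M :
  (forall t, 0 <= t -> M <= q (x + t%:C *: y) - t * q y) -> M <= lowering q y x.
Proof.
move=> h; apply: lb_le_inf; last by move=> _ [t t0 <-]; exact: h.
by eexists; exists 0 => /=.
Qed.

(** Parameters [s] for [x] and [t] for [x'] give [s + t] for the sum; scaling [x] by [t > 0] scales
    the parameter by [t]. *)
Lemma lowering_sublinear q y : sublinear q -> sublinear (lowering q y).
Proof.
move=> sq; split => [x x'|t x t0].
  rewrite -lerBlDr; apply: le_lowering => s s0.
  rewrite lerBlDr -lerBlDl; apply: le_lowering => t t0; rewrite lerBlDl.
  apply: (le_trans (lowering_le y (x + x') sq (addr_ge0 s0 t0))).
  by rewrite rmorphD scalerDl mulrDl (addrACA x) [leRHS]addrACA opprD lerD2r sq.1.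
have [->|tn0] := eqVneq t 0.
  rewrite mul0r scale0r; apply: (le_trans (lowering_le y 0 sq (lexx 0))).
  by rewrite scale0r addr0 mul0r subr0 (sublinear0 sq).
have tp : 0 < t by rewrite lt_def tn0.
rewrite -ler_pdivrMl //; apply: le_lowering => s s0; rewrite ler_pdivrMl //.
apply: (le_trans (lowering_le y _ sq (mulr_ge0 t0 s0))).
by rewrite rmorphM -scalerA -scalerDr (sublinearZ _ sq t0) mulrBr mulrA.
Qed.

Lemma lowering_le_id q y x : sublinear q -> lowering q y x <= q x.
Proof.
move=> sq; apply: (le_trans (lowering_le y x sq (lexx 0))).
by rewrite scale0r addr0 mul0r subr0.
Qed.

Lemma lowering_opp q y : sublinear q -> lowering q y (- y) <= - q y.
Proof.
move=> sq; apply: (le_trans (lowering_le y _ sq ler01)).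
by rewrite rmorph1 scale1r addNr mul1r (sublinear0 sq) add0r.
Qed.

(* Hahn-Banach without extending functionals from subspaces: a sublinear map that
   is minimal is fixed by all its lowerings, hence additive. Lowering [p] at [w]
   first forces the value [p w] at [w]. *)
Lemma minimal_sublinear p : sublinear p ->
  exists q, [/\ sublinear q, forall x, q x <= p x &
    forall r, sublinear r -> (forall x, r x <= q x) -> r = q].
Proof.
move=> sp; pose T := {q : V -> R | sublinear q /\ forall x, q x <= p x}.
(* The order is reversed, so that a maximal element for Zorn is a minimal sublinear map. *)
pose rel_ge (s t : T) := `[< forall x, sval t x <= sval s x >].
have [| | | |[q [sq qp]] qmin] := @Zorn T rel_ge.
- by move=> t; apply/asboolP.
- move=> r s t /asboolP rs /asboolP st; apply/asboolP => x.
  exact: le_trans (st x) (rs x).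
- move=> [s sP] [t tP] /asboolP /= st /asboolP /= ts; apply/eq_exist.
  by apply/funext => x; apply/le_anti; rewrite st ts.
- move=> A Atot; have [->|/set0P[s0 As0]] := eqVneq A set0.
    by exists (exist _ p (conj sp (fun x => lexx _))).
  (* A nonempty chain is bounded by its pointwise infimum, which is finite because
     [- p (- x) <= s x] for all its members. *)
  pose m x := inf [set sval s x | s in A].
  have mle x s : A s -> m x <= sval s x.
    move=> As; apply: ge_inf; last by exists s.
    exists (- p (- x)) => _ [[r [sr rp]] _ <-] /=.
    by apply: le_trans (sublinear_opp x sr); rewrite lerN2.
  have lem_inf x M : (forall s, A s -> M <= sval s x) -> M <= m x.
    move=> h; apply: lb_le_inf; first by exists (sval s0 x), s0.
    by move=> _ [s As <-]; exact: h.
  have sm : sublinear m.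
    split => [x y|t x t0].
      rewrite -lerBlDr; apply/lem_inf => s As.
      rewrite lerBlDr -lerBlDl; apply/lem_inf => t At; rewrite lerBlDl.
      (* The smaller of the two maps serves for both arguments; this is where the chain condition
         enters. *)
      have [/asboolP st|/asboolP ts] := Atot _ _ As At.
        apply: (le_trans (mle _ _ At)); apply: (le_trans ((svalP t).1.1 _ _)).
        by rewrite lerD2r.
      apply: (le_trans (mle _ _ As)); apply: (le_trans ((svalP s).1.1 _ _)).
      by rewrite lerD2l.
    have [->|tn0] := eqVneq t 0.
      rewrite mul0r scale0r; apply: (le_trans (mle _ _ As0)).
      by rewrite (sublinear0 (svalP s0).1).
    have tp : 0 < t by rewrite lt_def tn0.
    rewrite -ler_pdivrMl //; apply/lem_inf => s As; rewrite ler_pdivrMl //.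
    by apply: (le_trans (mle _ _ As)); exact: (svalP s).1.2.
  have mp x : m x <= p x by apply: le_trans (mle _ _ As0) _; exact: (svalP s0).2.
  exists (exist _ m (conj sm mp)) => s As; apply/asboolP => x; exact: mle.
exists q; split => // r sr rq.
have rp x : r x <= p x by exact: le_trans (rq x) (qp x).
suff /(congr1 sval) : exist _ r (conj sr rp) = exist _ q (conj sq qp) :> T by [].
by apply: qmin; apply/asboolP.
Qed.

Lemma hahn_banach_real p w : sublinear p ->
  exists u : V -> R, [/\ forall x y, u (x + y) = u x + u y,
    forall t x, u (t%:C *: x) = t * u x, forall x, u x <= p x & u w = p w].
Proof.
move=> sp.
have [u [su ule umin]] := minimal_sublinear (lowering_sublinear w sp).
have up x : u x <= p x by exact: le_trans (ule x) (lowering_le_id w x sp).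
have uD x y : u (x + y) = u x + u y.
  apply/le_anti; rewrite su.1 andTb -lerBrDr.
  (* By minimality [u] equals its lowering at [y], whose parameter [1] gives
     [u x <= u (x + y) - u y]. *)
  rewrite -[in leLHS](umin _ (lowering_sublinear y su)); last first.
    by move=> z; exact: lowering_le_id.
  by apply: (le_trans (lowering_le y x su ler01)); rewrite rmorph1 scale1r mul1r.
have uN x : u (- x) = - u x.
  by apply/eqP; rewrite -addr_eq0 -uD addNr (sublinear0 su).
exists u; split => // [t x|]; last first.
  apply/le_anti; rewrite up andTb -lerN2 -uN.
  exact: le_trans (ule _) (lowering_opp w sp).
have [t0|t0] := leP 0 t; first exact: sublinearZ.
rewrite -[t]opprK rmorphN scaleNr uN sublinearZ ?mulNr //.
by rewrite oppr_ge0 ltW.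
Qed.

(* The complexification x |-> u(x) - i u(ix) of a real functional u <= p is
   bounded by p because its value is made real by a rotation of x. *)
Lemma hahn_banach p w :
  (forall x y, p (x + y) <= p x + p y) ->
  (forall (c : R[i]) x, p (c *: x) = Normc.normc c * p x) ->
  exists f : {linear V -> R[i]^o},
    (forall x, Normc.normc (f x : R[i]) <= p x) /\ complex.Re (f w : R[i]) = p w.
Proof.
move=> pD pZ.
have sp : sublinear p.
  by split => // t x t0; rewrite pZ normc_real.
have [u [uD uZ up uw]] := hahn_banach_real w sp.
have uN x : u (- x) = - u x.
  by rewrite -scaleN1r -(rmorph1 (real_complex R)) -rmorphN uZ mulN1r.
pose f0 (x : V) : R[i]^o := (u x +i* - u ('i%C *: x))%C.
have f0lin : linear f0.
  move=> [a b] x y; rewrite /f0.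
  have E z : (a +i* b)%C *: z = a%:C *: z + b%:C *: ('i%C *: z).
    by rewrite scalerA -scalerDl; congr (_ *: _); simpc.
  have uE z : u ((a +i* b)%C *: z) = a * u z + b * u ('i%C *: z).
    by rewrite E uD !uZ.
  have ii : 'i%C *: ((a +i* b)%C *: x) = (a +i* b)%C *: ('i%C *: x).
    by rewrite !scalerA mulrC.
  rewrite scalerDr ii !uD !uE scalerA.
  have -> : 'i%C * 'i%C = -1 :> R[i] by simpc.
  rewrite scaleN1r uN.
  apply/eqP; rewrite eq_complex /=; apply/andP; split; apply/eqP; ring.
pose f : {linear V -> R[i]^o} :=
  HB.pack f0 (GRing.isLinear.Build R[i] V R[i]^o _ f0 f0lin).
exists f; split => // x.
have [fx0|z0] := eqVneq (f x : R[i]) 0.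
  have ux0 : u x = 0 by exact: (congr1 (@complex.Re R) fx0).
  by rewrite fx0 normc_0 -ux0.
set z : R[i] := f x in z0 *.
have nz : Normc.normc z != 0.
  by apply: contraNneq z0 => /Normc.eq0_normc ->.
pose c : R[i] := (Normc.normc z)%:C / z.
have nc : Normc.normc c = 1.
  by rewrite Normc.normcM Normc.normcV normc_real ?normc_ge0 // mulfV.
have fcx : (f (c *: x) : R[i]) = (Normc.normc z)%:C.
  by rewrite linearZ /= -/z; exact: divfK.
have <- : u (c *: x) = Normc.normc z by case: fcx.
by rewrite (le_trans (up _)) // pZ nc mul1r.
Qed.
End HahnBanach.

(** * Contractive functionals are completely contractive *)

Section Functionals.
Context {R : realType}.
Local Notation C := R[i].

Lemma opnorm_col n (x : 'cV[C]_n) : opnorm x <= norm2 x.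
Proof.
apply: opnorm_le => [|y]; first exact: norm2_ge0.
have -> : x *m y = y 0 0 *: x.
  by apply/colP => i; rewrite !mxE big_ord1 mulrC.
by rewrite norm2Z mulrC ler_wpM2l ?norm2_ge0 ?norm2_entry.
Qed.

Lemma opnorm_row n (x : 'rV[C]_n) : opnorm x <= norm2 x^T.
Proof.
apply: opnorm_le => [|y]; first exact: norm2_ge0.
apply: norm2_le; first by rewrite mulr_ge0 ?norm2_ge0.
rewrite exprMn !sqr_norm2 big_ord1 mxE.
apply: le_trans (cauchy_schwarz (fun i => Normc.normc (x^T i 0))
  (fun i => Normc.normc (y i 0))).
rewrite ler_pXn2r ?nnegrE ?normc_ge0 //; last first.
  by apply: sumr_ge0 => i _; rewrite mulr_ge0 ?normc_ge0.
apply: (le_trans (normc_sum _ _ _)); apply: ler_sum => i _.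
by rewrite Normc.normcM !mxE.
Qed.

(* Smith's lemma for scalar targets: [norm2 y ^+ 2 = y^* f(A) x = f (y^* A x)]
   for [y = f(A) x]. *)
Lemma functional_cb (V : matrixNormedSpace R) (f : {linear V -> MINC R})
    (fle : forall v, vnorm (f v) <= vnorm v) m n (A : 'M[V]_(m.+1, n.+1)) :
  mnorm (map_mx f A) <= mnorm A.
Proof.
have A0 : 0 <= mnorm A by exact: (matrix_norm_ge0 (@mnormP _ _)).
apply: opnorm_le => // x; set y : 'cV[C]_m.+1 := _ *m x.
have [y0|y0] := eqVneq (norm2 y) 0.
  by rewrite y0 mulr_ge0 ?norm2_ge0.
have yp : 0 < norm2 y by rewrite lt_def y0 norm2_ge0.
pose ys : 'rV[C]_m.+1 := \row_i ((y i 0)^*)%C.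
have ysE : norm2 ys^T = norm2 y.
  rewrite /norm2; congr Num.sqrt; apply: eq_bigr => i _; rewrite 2!mxE.
  by case: (y i 0) => a b /=; rewrite sqrrN.
have yy : f (ractmx (lactmx ys A) x 0 0) = (real_complex R (norm2 y ^+ 2) : C).
  have -> : f (ractmx (lactmx ys A) x 0 0) = (ys *m y) 0 0.
    transitivity (map_mx f (ractmx (lactmx ys A) x) 0 0); first by rewrite [RHS]mxE.
    rewrite map_ractmx map_lactmx /y mulmxA !mxE; apply: eq_bigr => k _.
    rewrite !mxE mulrC; congr (_ * _); apply: eq_bigr => l _.
  rewrite mxE sqr_norm2 rmorph_sum /=; apply: eq_bigr => i _; rewrite mxE.
  case: (y i 0) => a b; simpc => /=; rewrite sqr_sqrtr ?addr_ge0 ?sqr_ge0 //.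
  apply/eqP; rewrite eq_complex /=; apply/andP; split; apply/eqP; ring.
(* Multiplying by [norm2 y > 0] turns the left side into [f (ys A x)], and [ys = y^*] has the norm
   of [y]. *)
rewrite -(ler_pM2l yp) -expr2.
have := fle (ractmx (lactmx ys A) x 0 0).
rewrite yy vnorm_MINC normc_real ?sqr_ge0 // => /le_trans; apply.
apply: (le_trans (vnorm_le_mnorm _ _ _)).
apply: (le_trans (matrix_norm_act (@mnormP _ _) _ _ _)).
rewrite mulrA ler_pM ?mulr_ge0 ?opnorm_ge0 ?opnorm_col //.
by rewrite ler_wpM2r // -ysE opnorm_row.
Qed.

End Functionals.

(** * Linear maps out of V_X and Q_X *)

(** Given additivity, homogeneity need only be checked on the terms of the expansion of [D] over its
    support. *)
Lemma fglift_linear (K : nzRingType) (T : choiceType) (M : lmodType K)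
    (f : T -> M) : linear (fglift f : {freeg T / K} -> M).
Proof.
have fB : zmod_morphism (fglift f : {freeg T / K} -> M) by exact: lift_is_additive.
pose F : {additive {freeg T / K} -> M} :=
  HB.pack (fglift f : {freeg T / K} -> M)
    (GRing.isZmodMorphism.Build {freeg T / K} M _ fB).
have FZ c D : F (c *: D) = c *: F D.
  rewrite -{2}[D]freeg_sumE !(raddf_sum F) scaler_sumr.
  by apply: eq_bigr => x _; rewrite /= !liftU scalerA.
by move=> c u v; rewrite -[LHS]/(F (c *: u + v)) raddfD FZ.
Qed.

Section Lifting.
Context {R : realType}.
Local Notation "t %:C" := (real_complex R t).

(** Hahn-Banach for [vnorm] at [w] gives a functional whose value at [w] has real part
    [vnorm w > 0]. *)
Lemma separating_functional (W : matrixNormedSpace R) (w : W) : w != 0 ->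
  exists f : {linear W -> MINC R},
    (forall m n (A : 'M[W]_(m.+1, n.+1)), mnorm (map_mx f A) <= mnorm A) /\
    f w != 0.
Proof.
move=> w0; have [f [fle fw]] := hahn_banach w (@vnormD R W) (@vnormZ R W).
exists f; split => [m n A|].
  by apply: functional_cb => v; rewrite vnorm_MINC.
apply: contraNneq w0 => fw0; apply/eqP/vnorm_eq0.
by rewrite -fw -[LHS]/(complex.Re (f w : R[i])) (_ : (f w : R[i]) = 0).
Qed.

(** The strict inequality makes [M] positive even when [L = 0], so division by [M] is possible. *)
Lemma cb_bound_contract (X : arrayWeightedSet R) (W : matrixNormedSpace R)
    (phi : X -> W) L M : cb_bound X W phi L -> L < M ->
  completely_contractive X W (fun x => (M^-1)%:C *: phi x).
Proof.
move=> [L0 Lphi] LM; have M0 : 0 < M by exact: le_lt_trans LM.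
apply/completely_contractiveP => m n A.
have -> : map_mx (fun x => (M^-1)%:C *: phi x) A =
    map_mx ( *:%R (M^-1)%:C) (map_mx phi A) :> 'M[W]_(_, _).
  by apply/matrixP => i j; rewrite !mxE.
rewrite /= (matrix_normZ (@mnormP _ _)) normc_real ?invr_ge0 ?(ltW M0) //.
rewrite ler_pdivrMl //; apply: (le_trans (Lphi _ _ A)).
by rewrite ler_wpM2r ?(ltW LM) //; exact: (array_weight_ge0 (aweightP X)).
Qed.

Lemma quotV_lift (X : arrayWeightedSet R) (W : matBanachSpace R)
    (phi : X -> W) : completely_bounded X W phi ->
  exists g : {linear QX X -> W}, forall x, g (quot_map X (theta x)) = phi x.
Proof.
move=> [L [L0 Lphi]].
pose F : {linear freeV X -> W} := HB.pack (fglift (phi : {classic X} -> W))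
  (GRing.isLinear.Build R[i] (freeV X) W _ _
     (fglift_linear (phi : {classic X} -> W))).
have Ftheta x : F (theta x) = phi x by rewrite /F /= liftU scale1r.
have F0 v : v \in @nullV R X -> F v = 0.
  move=> /asboolP v0; apply: contrapT => /eqP /separating_functional[f [fle]].
  apply/negP; rewrite negbK.
  have cfL : cb_bound X (MINC R) (fun x => f (phi x)) L.
    split => // m n A; apply: le_trans (Lphi m n A).
    rewrite (_ : map_mx (fun x => f (phi x)) A = map_mx f (map_mx phi A)) ?fle //.
    by apply/matrixP => i j; rewrite !mxE.
  have L1 : L < L + 1 by rewrite ltrDl.
  (* Dividing by [L + 1] makes [f \o F] one of the functionals that define N_X, so it vanishes at
     [v]; this contradicts [f (F v) != 0]. *)
  pose h : {linear freeV X -> MINC R} := ((L + 1)^-1)%:C \*: (f \o F).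
  have := v0 h; rewrite (_ : h \o _ = fun x => ((L + 1)^-1)%:C *: f (phi x)).
    move=> /(_ (cb_bound_contract cfL L1)) /(congr1 ( *:%R (L + 1)%:C)).
    rewrite /= scalerA -rmorphM mulfV ?scale1r ?scaler0 => [->//|].
    by rewrite gt_eqF // ltr_wpDl.
  by apply/funext => x; rewrite -[in RHS]Ftheta.
have [g gF] := lquot_lift F0.
by exists g => x; rewrite gF Ftheta.
Qed.

Lemma cb_bound_quotV (X : arrayWeightedSet R) (W : matBanachSpace R)
    (g : {linear QX X -> W}) L :
  cb_bound X W (fun x => g (quot_map X (theta x))) L ->
  forall m n (A : 'M[QX X]_(m.+1, n.+1)), mnorm (map_mx g A) <= L * mnorm A.
Proof.
move=> gL m n A.
have A0 : 0 <= mnorm A by exact: (matrix_norm_ge0 (@mnormP _ _)).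
(* [d] is chosen so that [d * mnorm A <= e]; the [+ 1] covers [mnorm A = 0]. The competitor in the
   supremum is [g] divided by [L + d]. *)
apply/ler_addgt0Pr => e e0; set d := e / (mnorm A + 1).
have d0 : 0 < d by rewrite divr_gt0 // ltr_wpDl.
have LM : L < L + d by rewrite ltrDl.
have M0 : 0 < L + d by rewrite ltr_wpDl // gL.1.
pose h : {linear quotV X -> W} := ((L + d)^-1)%:C \*: g.
have := @qnorm_ub _ _ _ _ A _ h (cb_bound_contract gL LM).
rewrite (_ : map_mx h A = map_mx ( *:%R ((L + d)^-1)%:C) (map_mx g A)); last first.
  by apply/matrixP => i j; rewrite !mxE.
rewrite (matrix_normZ (@mnormP _ _)) normc_real ?invr_ge0 ?(ltW M0) //.
rewrite ler_pdivrMl // => /le_trans; apply.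
rewrite mulrDl lerD2l /d mulrAC ler_pdivrMr ?ltr_wpDl //.
by rewrite ler_wpM2l ?ltW // ltrDl.
Qed.

End Lifting.

(** * Limits in matrix-normed spaces *)

Section Convergence.
Context {R : realType} {W : matrixNormedSpace R}.

Lemma vcvg_unique (a : nat -> W) x y : vcvg a x -> vcvg a y -> x = y.
Proof.
move=> ax ay; apply/eqP; rewrite -subr_eq0; apply/eqP/vnorm_eq0.
have z : (fun p => vnorm (a p - x) + vnorm (a p - y)) @ \oo --> (0 : R).
  by rewrite -[X in _ --> X]addr0; exact: cvgD ax ay.
apply/le_anti; rewrite vnorm_ge0 andbT.
apply: (cvgr_to_ge z); apply: nearW => p.
by rewrite (vnormBC (a p) x) vnormB_le.
Qed.

Lemma vcvg_linear (c : R[i]) (a b : nat -> W) x y : vcvg a x -> vcvg b y ->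
  vcvg (fun p => c *: a p + b p) (c *: x + y).
Proof.
move=> ax bx.
have z : (fun p => Normc.normc c * vnorm (a p - x) + vnorm (b p - y))
    @ \oo --> (0 : R).
  have := cvgD (cvgM (cvg_cst (Normc.normc c)) ax) bx.
  by rewrite mulr0 addr0; exact.
apply: (squeeze0 _ z) => p; rewrite vnorm_ge0 opprD addrACA -scalerBr.
by rewrite -vnormZ vnormD.
Qed.

(** The norm of an array is at most the sum of the norms of its entries, so entrywise convergence is
    enough. *)
Lemma mnorm_cvg m n (B : nat -> 'M[W]_(m.+1, n.+1))
    (A : 'M[W]_(m.+1, n.+1)) :
  (forall i j, vcvg (fun p => B p i j) (A i j)) ->
  (fun p => mnorm (B p)) @ \oo --> mnorm A.
Proof.
move=> BA; apply/subr_cvg0/norm_cvg0P.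
have z : (fun p => \sum_i \sum_j vnorm (B p i j - A i j)) @ \oo --> (0 : R).
  by apply: cvg_sum0 => i; apply: cvg_sum0 => j; exact: BA.
apply: (squeeze0 _ z) => p; rewrite normr_ge0 andTb.
apply: (le_trans (matrix_norm_distB (@mnormP _ _) _ _)).
apply: (le_trans (mnorm_le_sum _)).
by apply: ler_sum => i _; apply: ler_sum => j _; rewrite !mxE.
Qed.

End Convergence.

(** * Extension to the completion by continuity *)

Section CompletionLift.
Context {R : realType} {V : matrixNormedSpace R} {W : matBanachSpace R}.

(** The constant [L] serves to build [h] as a limit along Cauchy sequences. Any bound [M] of [g] at
    a given array size then passes to the limit unchanged, so no constant is lost. *)
Lemma completion_lift (g : {linear V -> W}) (L : R) :
  0 < L -> (forall v, vnorm (g v) <= L * vnorm v) ->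
  exists h : {linear completion V -> W},
    (forall v, h (kappa V v) = g v) /\
    forall M m n,
      (forall A : 'M[V]_(m.+1, n.+1), mnorm (map_mx g A) <= M * mnorm A) ->
      forall A : 'M[completion V]_(m.+1, n.+1),
        mnorm (map_mx h A) <= M * mnorm A.
Proof.
move=> L0 gL.
have /choice[l lP] : forall u : cauchySeq V, exists w,
    vcvg (fun p => g (cauchy_at p u)) w.
  move=> u; apply: mb_complete => e e0.
  have [N hN] := cauchySeqP u (divr_gt0 e0 L0).
  exists N => p q Np Nq; rewrite -linearB; apply: (le_lt_trans (gL _)).
  by rewrite mulrC -ltr_pdivlMr //; exact: hN.
have llin : linear l.
  move=> c u v; apply: (vcvg_unique (lP _)).
  have := vcvg_linear c (lP u) (lP v); congr vcvg.
  by apply/funext => p; rewrite !linearP.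
pose f : {linear cauchySeq V -> W} :=
  HB.pack l (GRing.isLinear.Build R[i] (cauchySeq V) W _ l llin).
have f0 u : u \in @null_pred R V -> f u = 0.
  move=> /null_predP u0; apply: (vcvg_unique (lP u)).
  have z : (fun p => L * vnorm (cauchy_at p u)) @ \oo --> (0 : R).
    by rewrite -[X in _ --> X](mulr0 L); apply: cvgM => //; exact: cvg_cst.
  by apply: (squeeze0 _ z) => p; rewrite vnorm_ge0 subr0 gL.
have [h hf] := lquot_lift f0.
exists h; split => [v|M m n gM A].
  rewrite [LHS]hf; apply: (vcvg_unique (lP _)).
  rewrite /vcvg; under eq_fun do rewrite subrr vnorm0.
  exact: cvg_cst.
rewrite (complV_mxP A); set U := map_mx (@complV_repr R V) A.
have hU : (fun p => mnorm (map_mx g (map_mx (cauchy_at p) U))) @ \oo -->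
    mnorm (map_mx h (map_mx (@complV_pi R V) U)).
  apply: mnorm_cvg => i j; rewrite !mxE hf.
  have := lP (complV_repr (A i j)); congr vcvg.
  by apply/funext => p; rewrite !mxE.
have MU : (fun p => M * mnorm (map_mx (cauchy_at p) U)) @ \oo -->
    M * compl_norm (map_mx (@complV_pi R V) U).
  by apply: cvgM; [exact: cvg_cst | exact: compl_normE].
by apply: (ler_cvg_to hU MU); apply: nearW => p; exact: gM.
Qed.

End CompletionLift.

(** * Bounds from and for the completely bounded norm *)

Section CbNorm.
Context {R : realType} {V W : matrixNormedSpace R}.

Lemma cb_norm_le (f : V -> W) (M : R) : 0 <= M ->
  (forall m n (A : 'M[V]_(m.+1, n.+1)), mnorm (map_mx f A) <= M * mnorm A) ->
  (cb_norm V W f <= M%:E)%E.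
Proof.
move=> M0 fM; apply: ge_ereal_sup => _ [mn _ <-].
apply: ge_ereal_sup => _ [A /= A1 <-]; rewrite lee_fin.
by apply: (le_trans (fM _ _ A)); rewrite ler_piMr.
Qed.

Lemma cb_linear_bounded (f : {linear V -> W}) : cb_linear V W f ->
  exists2 M : R, 0 <= M & forall v, vnorm (f v) <= M * vnorm v.
Proof.
move=> fcb.
have ub v : vnorm v <= 1 -> ((vnorm (f v))%:E <= cb_norm V W f)%E.
  move=> v1; apply: (@le_trans _ _ (amp_norm f 0 0)).
    apply: ereal_sup_ubound; exists (const_mx v) => //.
    by rewrite /vnorm; congr (_ _)%:E; apply/matrixP => i j; rewrite !mxE.
  by apply: ereal_sup_ubound; exists (0, 0)%N.
have [M M0 fM] : exists2 M : R, 0 <= M & forall v, vnorm v <= 1 -> vnorm (f v) <= M.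
  move: fcb ub; rewrite /cb_linear; case: cb_norm => // [r|] _ ub.
    exists `|r| => // v /ub; rewrite lee_fin => /le_trans; apply; exact: ler_norm.
  (* The value [-oo] is excluded by the vector [0] of the unit ball. *)
  by have := ub 0; rewrite vnorm0 ler01 => /(_ isT).
exists M => // v; have [v0|v0] := eqVneq (vnorm v) 0.
  by rewrite v0 (vnorm_eq0 v0) linear0 vnorm0 mulr0.
have vp : 0 < vnorm v by rewrite lt_def v0 vnorm_ge0.
have nc : Normc.normc (real_complex R (vnorm v)^-1) = (vnorm v)^-1.
  by rewrite normc_real // invr_ge0 vnorm_ge0.
have := fM (real_complex R (vnorm v)^-1 *: v).
by rewrite linearZ !vnormZ nc mulVf // lexx mulrC ler_pdivrMr //; exact.
Qed.

End CbNorm.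

(** * Uniqueness by density and generation *)

(** Through a nearby [kappa V v], where the maps agree, their difference at [y] is at most
    [(M + N) * vnorm (y - kappa V v)]. *)
Lemma linear_eq_completion (R : realType) (V : matrixNormedSpace R)
    (W : matrixNormedSpace R) (f g : {linear completion V -> W}) :
  cb_linear (completion V) W f -> cb_linear (completion V) W g ->
  (forall v, f (kappa V v) = g (kappa V v)) -> forall y, f y = g y.
Proof.
move=> /cb_linear_bounded[M M0 fM] /cb_linear_bounded[N N0 gN] fg y.
apply/eqP; rewrite -subr_eq0; apply/eqP/vnorm_eq0/le_anti.
rewrite vnorm_ge0 andbT; apply/ler_addgt0Pr => e e0; rewrite add0r.
have MN0 : 0 < M + N + 1 by rewrite ltr_wpDl ?addr_ge0.
have [v vy] := kappa_dense y (divr_gt0 e0 MN0).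
apply: (le_trans (vnormB_le (f (kappa V v)) _ _)).
rewrite [in X in _ + X]fg -!linearB.
apply: (le_trans (lerD (fM _) (gN _))); rewrite (vnormBC _ y) -mulrDl.
apply: (@le_trans _ _ ((M + N + 1) * (e / (M + N + 1)))).
  by rewrite ler_pM ?vnorm_ge0 ?addr_ge0 // lerDl.
by rewrite mulrC divfK ?gt_eqF.
Qed.

(** Every element of Q_X is the class of a finite combination of generators. *)
Lemma linear_eq_theta (R : realType) (X : arrayWeightedSet R)
    (W : lmodType R[i]) (f g : {linear QX X -> W}) :
  (forall x, f (quot_map X (theta x)) = g (quot_map X (theta x))) ->
  forall v, f v = g v.
Proof.
move=> fg v; set u : freeV X := lquot_repr v.
have -> : v = quot_map X u by rewrite /quot_map /= lquot_reprK.
rewrite (freeV_sumE u) !linear_sum; apply: eq_bigr => x _.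
by rewrite !linearZ fg.
Qed.

Theorem theorem4p4 (R : realType) (X : arrayWeightedSet R)
    (W : matBanachSpace R) (phi : X -> W)
    (phi_cb : completely_bounded X W phi) :
  exists phihat : {linear MBanSp X -> W},
    [/\ cb_linear (MBanSp X) W phihat,
        forall x : X, phihat (eta X x) = phi x,
        (forall psi : {linear MBanSp X -> W},
           cb_linear (MBanSp X) W psi ->
           (forall x : X, psi (eta X x) = phi x) ->
           forall y : MBanSp X, psi y = phihat y)
      & (cb_norm (MBanSp X) W phihat <= cbnd X W phi)%E].
Proof.
have [g gphi] := quotV_lift phi_cb.
have gb L : cb_bound X W phi L -> forall m n (A : 'M[QX X]_(m.+1, n.+1)),
    mnorm (map_mx g A) <= L * mnorm A.
  by move=> cbL; apply: cb_bound_quotV; under eq_fun do rewrite gphi.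
have [L0 cbL0] := phi_cb.
have L1 : 0 < L0 + 1 by rewrite ltr_wpDl // cbL0.1.
(* The bound is enlarged from [L0] to [L0 + 1] to be positive; this does not affect the final
   estimate. *)
have gv v : vnorm (g v) <= (L0 + 1) * vnorm v.
  have := gb _ cbL0 _ _ (const_mx v : 'M_(1, 1)).
  rewrite (_ : map_mx g _ = const_mx (g v)) => [/le_trans|]; last first.
    by apply/matrixP => i j; rewrite !mxE.
  apply; rewrite ler_wpM2r ?lerDl //.
  exact: (matrix_norm_ge0 (@mnormP _ _)).
have [h [hg hM]] := completion_lift L1 gv.
have hle L : cb_bound X W phi L -> (cb_norm (MBanSp X) W h <= L%:E)%E.
  move=> cbL; apply: cb_norm_le => [|m n A]; first exact: cbL.1.
  by apply: hM; exact: gb.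
have hcb : cb_linear (MBanSp X) W h.
  by apply: (le_lt_trans (hle _ cbL0)); rewrite ltry.
exists h; split => // [x|psi psicb psiphi|].
- by rewrite /eta hg gphi.
- apply: linear_eq_completion => // v.
  apply: (linear_eq_theta (f := psi \o kappa (QX X))
    (g := h \o kappa (QX X))) => x /=.
  by rewrite -/(eta X x) psiphi hg gphi.
(* The same [h] obeys every bound [L] of [phi], hence also their infimum. *)
- by apply: le_ereal_inf_tmp => _ [L cbL <-]; exact: hle.
Qed.
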